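(* Let $N\ge1$ and let $K$ be a finite, orientable $N$-dimensional simplicial complex in which every $(N-1)$-simplex is contained in exactly two $N$-simplexes (so $K$ has no free $(N-1)$-face). Let $p\in[0,1]$ and let $M$ be the transition matrix of the $p$-lazy down random walk on the $N$-simplexes of $K$. For $\sigma_0\in S_N$ let $p_0^{\sigma_0}$ be the point mass at $\sigma_0$ and $p_t^{\sigma_0}=M^tp_0^{\sigma_0}$, so that $p_t^{\sigma_0}(\sigma')$ is the probability of finding the walker at $\sigma'$ at time $t$ when starting from $\sigma_0$. (i) If $0<p<1$, then $p_\infty=\lim_{t\to\infty}p_t^{\sigma_0}$ exists, is independent of the starting point $\sigma_0$, and is equal to the projection onto the kernel of $\Delta_N^{down}$, i.e. $p_\infty=\mathbb{P}_{\ker\delta_{N-1}^*}(p_0^{\sigma_0})$, where $\ker\Delta_N^{down}=\ker\delta_{N-1}^*$. Also, the dimension of $H_N(K)$ equals the dimension of $\ker\delta_{N-1}^*$, since in the maximum dimension $\ker\Delta_N=\ker\Delta_N^{down}$ (as $\Delta_N^{up}=0$). The same holds for $p=0$ if $K$ has no disorientable $N$-connected component of constant $(N-1)$-degree. (ii) If $p\ge\frac12$, then $$\operatorname{dis}(p_t^{\sigma_0},p_\infty)=O\left(\left(1-\frac{2(1-p)}{N+1}\lambda_N\right)^t\right),$$ where $p_\infty=\lim_{t\to\infty}p_t^{\sigma_0}$ and $\lambda_N$ is the spectral gap (smallest nonzero eigenvalue) of $\Delta_N^{down}$.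
   Context: $K$ is an abstract simplicial complex on a finite vertex set; $S_d$ denotes its set of $d$-simplexes. For $d\ge1$ each $d$-simplex has two orientations, $[\sigma]$ and $-[\sigma]$ (classes of vertex orderings modulo even permutations). $C^d(K)$ is the real vector space of functions $f$ on oriented $d$-simplexes with $f(-[\sigma])=-f([\sigma])$ (for $d=0$, all real functions on vertices). The coboundary $\delta_d:C^d(K)\to C^{d+1}(K)$ is $\delta_df([i_0,\dots,i_{d+1}])=\sum_{j=0}^{d+1}(-1)^jf([i_0,\dots,i_{j-1},i_{j+1},\dots,i_{d+1}])$. $H_N(K)$ is the $N$-th simplicial homology with real coefficients. Cochain spaces carry the inner product $\langle f,g\rangle=\sum_{\sigma\in S_d}w(\sigma)f([\sigma])g([\sigma])$ (one orientation per simplex), with the normalized weights: $w(\sigma)=1$ for facets (maximal simplexes), and $w(\sigma)=\deg\sigma$, the sum of the weights of the simplexes of dimension one higher containing $\sigma$, otherwise. Here $w=1$ on $N$-simplexes and $w=2$ on $(N-1)$-simplexes. $\delta_{d}^*:C^{d+1}(K)\to C^{d}(K)$ is the adjoint of $\delta_{d}$. On $C^N(K)$ the normalized down Laplacian is $\Delta_N^{down}=\delta_{N-1}\delta_{N-1}^*$, the up Laplacian is $\Delta_N^{up}=\delta_N^*\delta_N$ (zero, since there are no $(N+1)$-simplexes), and the full Laplacian is $\Delta_N=\Delta_N^{up}+\Delta_N^{down}$. $\mathbb{P}_V$ denotes the orthogonal projection onto a subspace $V$, and $\operatorname{dis}$ is the distance induced by the norm on $C^N(K)$. Orientable: there is a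 choice of orientations of the $N$-simplexes such that any two distinct $N$-simplexes sharing an $(N-1)$-simplex induce opposite orientations on it. Fix such a choice; it identifies $C^N(K)$ with the space of real functions on $S_N$, and functions on $S_N$ (such as $p_t^{\sigma_0}$) and $M$ are regarded as elements of, respectively an operator on, $C^N(K)$ through this identification. Random walk: $M$ is the transition matrix on state space $S_N$ with $P_{\sigma\to\sigma'}=p$ if $\sigma'=\sigma$; $P_{\sigma\to\sigma'}=\frac{1-p}{N+1}$ if $\sigma'\ne\sigma$ and $\sigma,\sigma'$ share an $(N-1)$-face; and $0$ otherwise. $N$-connected components: call two $N$-simplexes equivalent if they are joined by a chain of $N$-simplexes in which consecutive ones share an $(N-1)$-face; the $N$-connected components of $K$ are the subcomplexes generated by the equivalence classes. Constant $(N-1)$-degree means that all $(N-1)$-simplexes of the component are contained in the same number of $N$-simplexes. Disorientable: there is a choice of orientations of the $N$-simplexes such that whenever two distinct $N$-simplexes intersect in an $(N-1)$-simplex they induce the same orientation on it.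
   Formalization: Independence of the limit from the starting point is stated only for starting points in the same N-connected component; for several components (e.g. two disjoint triangles, N=1) the literal claim is false, as the limit is supported on the component of the starting simplex. *)

(* Defs.v *)
From HB Require Import structures.
From mathcomp Require Import all_boot all_order all_fingroup all_algebra.
From mathcomp Require Import all_classical all_reals all_analysis.

Set Implicit Arguments.
Unset Strict Implicit.
Unset Printing Implicit Defensive.

Import Order.TTheory GRing.Theory Num.Theory.
Import numFieldNormedType.Exports.

Local Open Scope ring_scope.

Section Complexes.
Variable V : finType.
Implicit Types (K : {set {set V}}) (s t : {set V}) (d n : nat).

(* Simplexes are nonempty; vertices of V that carry no simplex are allowed. *)
Definition simplicial_complex K : Prop :=
  finset.set0 \notin K /\
  forall s t, s \in K -> t \subset s -> t != finset.set0 -> t \in K.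

Definition simplexes K d : {set {set V}} := [set s in K | #|s| == d.+1]%SET.

Definition dim_complex K d : Prop :=
  simplexes K d != finset.set0 /\ forall s, s \in K -> (#|s| <= d.+1)%N.

Definition coface_degree K n t : nat :=
  #|[set s in simplexes K n.+1 | t \subset s]%SET|.

Definition facet K s : bool :=
  (s \in K) && [forall t in K, ~~ (s \proper t)].

(* The recursion goes up in dimension; [m] is fuel, and #|V| - #|s| is enough
   (see [weightE]). *)
Fixpoint weight_rec K (m : nat) s : nat :=
  if m is m'.+1 then
    if facet K s then 1%N
    else (\sum_(t in K | (s \subset t) && (#|t| == #|s|.+1)) weight_rec K m' t)%N
  else 1%N.

Definition weight K s : nat := weight_rec K (#|V| - #|s|) s.

Definition share_face K n s s' : bool :=
  [exists t in simplexes K n, (t \subset s) && (t \subset s')].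

Definition down_adj K n : rel {set V} := fun s s' =>
  [&& s \in simplexes K n.+1, s' \in simplexes K n.+1 & share_face K n s s'].

Definition connectedN K n : rel {set V} := connect (down_adj K n).

(* The n.+1-connected component of [s]: all nonempty faces of the
   n.+1-simplexes that are connected to [s]. *)
Definition component K n s : {set {set V}} :=
  [set t | (t != finset.set0) &&
           [exists s', connectedN K n s s' && (t \subset s')]]%SET.

Definition constant_degree K n : Prop :=
  exists k : nat, forall t, t \in simplexes K n -> coface_degree K n t = k.

End Complexes.

Notation simplex K d := {s : {set _} | s \in simplexes K d}.

Section Orderings.
Variable V : finType.

Definition ordering d := {ffun 'I_d.+1 -> V}.

Implicit Types (K : {set {set V}}).

Definition vertices d (x : ordering d) : {set V} := [set x i | i : 'I_d.+1]%SET.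

Definition orders d (x : ordering d) (s : {set V}) : bool :=
  injectiveb x && (vertices x == s).

Definition oriented K d (x : ordering d) : bool :=
  injectiveb x && (vertices x \in K).

Definition reorder d (x : ordering d) (s : 'S_d.+1) : ordering d :=
  [ffun i => x (s i)].

Definition face d (j : 'I_d.+2) (x : ordering d.+1) : ordering d :=
  [ffun i => x (lift j i)].

(* For an injective [x]: 1 if [y] = [x] as oriented simplexes, -1 if
   [y] = -[x], and 0 if x and y do not order the same simplex.  A vertex has
   a single ordering. *)
Definition osign d (x y : ordering d) : int :=
  if [pick s : 'S_d.+1 | y == reorder x s] is Some s then (-1) ^+ s else 0.

(* Since the faces of [x] are (-1)^j [face j x], the orientation that [x]
   induces on the simplex of y is (incidence x y) [y]; incidence x y = 0 when
   that simplex is not a face of the simplex of x. *)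
Definition incidence d (x : ordering d.+1) (y : ordering d) : int :=
  \sum_(j < d.+2) (-1) ^+ j * osign (face j x) y.

Lemma simplex_card K d (s : simplex K d) : d.+1 = #|val s|.
Proof. by case: s => s /= /[!inE] /andP[_ /eqP]. Qed.

Definition std_ord K d (s : simplex K d) : ordering d :=
  [ffun i => enum_val (cast_ord (simplex_card s) i)].

Definition orientation K d (o : simplex K d -> ordering d) : Prop :=
  forall s, orders (o s) (val s).

Definition coherent K n (o : simplex K n.+1 -> ordering n.+1) : Prop :=
  orientation o /\
  forall (s s' : simplex K n.+1) (t : simplex K n) (y : ordering n),
    s != s' -> val t \subset val s -> val t \subset val s' ->
    orders y (val t) -> incidence (o s) y = - incidence (o s') y.

Definition disorienting K n (o : simplex K n.+1 -> ordering n.+1) : Prop :=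
  orientation o /\
  forall (s s' : simplex K n.+1) (t : simplex K n) (y : ordering n),
    s != s' -> val t \subset val s -> val t \subset val s' ->
    orders y (val t) -> incidence (o s) y = incidence (o s') y.

Definition disorientable K n : Prop :=
  exists o : simplex K n.+1 -> ordering n.+1, disorienting o.

End Orderings.

Section Cochains.
Variables (R : realType) (V : finType) (K : {set {set V}}).

(* An oriented simplex is a class of orderings modulo even permutations, so a
   cochain is encoded as an alternating function of orderings, extended by 0
   to the functions 'I_d.+1 -> V that do not order a simplex of K
   (see [cochain_spaceP]). *)
Definition pre_cochain d := {ffun ordering V d -> R^o}.

Definition eval_at d (x : ordering V d) (f : pre_cochain d) : R^o := f x.
Definition alt_defect d (x : ordering V d) (s : 'S_d.+1) (f : pre_cochain d)
  : R^o := f (reorder x s) - (-1) ^+ s * f x.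

Definition cochain_space d : {vspace pre_cochain d} :=
  ((\bigcap_(x : ordering V d | ~~ oriented K x) lker (linfun (eval_at x))) :&:
   (\bigcap_(x : ordering V d) \bigcap_(s : 'S_d.+1)
      lker (linfun (alt_defect x s))))%VS.

Local Notation cochain d := (subvs_of (cochain_space d)).

Definition cochain_val d (f : cochain d) : ordering V d -> R := vsval f.

Definition pre_coboundary d (f : pre_cochain d) : pre_cochain d.+1 :=
  [ffun x => if oriented K x then \sum_(j < d.+2) (-1) ^+ j * f (face j x)
             else 0].

Definition coboundary d : 'Hom(cochain d, cochain d.+1) :=
  linfun (fun f : cochain d =>
    vsproj (cochain_space d.+1) (pre_coboundary (vsval f)) : cochain d.+1).

(* The alternating function that is 1 at [x], and 0 off the two orientations
   of the simplex of x. *)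
Definition pre_elem d (x : ordering V d) : pre_cochain d :=
  [ffun y => if oriented K x then (osign x y)%:~R else 0].

Definition elem d (x : ordering V d) : cochain d :=
  vsproj (cochain_space d) (pre_elem x).

(* A real chain \sum_s c_s [s] is identified with the alternating function
   whose value at [s] is c_s, so that chains live in the same space as
   cochains and the chain [x] is [elem x] (see [boundary_elem]). *)
Definition boundary d : 'Hom(cochain d.+1, cochain d) :=
  linfun (fun c : cochain d.+1 =>
    \sum_(s : simplex K d.+1) cochain_val c (std_ord s) *:
       \sum_(j < d.+2) (-1) ^+ j *: elem (face j (std_ord s))).

Definition cycles d : {vspace cochain d} :=
  match d return {vspace cochain d} with
  | 0 => fullv
  | d'.+1 => lker (boundary d')
  end.

(* The quotient cycles / boundaries, realized as a complement of the
   boundaries in the cycles. *)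
Definition homology d : {vspace cochain d} :=
  (cycles d :\: limg (boundary d))%VS.

(* The product does not depend on the orientation chosen on each simplex (see
   [cochain_ipE]). *)
Definition cochain_ip d (f g : cochain d) : R :=
  \sum_(s : simplex K d) (weight K (val s))%:R *
    cochain_val f (std_ord s) * cochain_val g (std_ord s).

Definition dis d (f g : cochain d) : R :=
  Num.sqrt (cochain_ip (f - g) (f - g)).

Definition cvg_cochain d (u : nat -> cochain d) (l : cochain d) : Prop :=
  ((fun t => dis (u t) l) @ \oo --> (0 : R))%classic.

(* [xget] selects the object with the defining property; that it exists and is
   unique on a simplicial complex is [adjointP], [adjoint_uniq], [orth_projP]
   and [orth_proj_uniq]. *)
Definition is_adjoint d e (f : 'Hom(cochain d, cochain e))
    (g : 'Hom(cochain e, cochain d)) : Prop :=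
  forall u v, cochain_ip (f u) v = cochain_ip u (g v).

Definition adjoint d e (f : 'Hom(cochain d, cochain e))
    : 'Hom(cochain e, cochain d) :=
  xget 0 (is_adjoint f).

Definition is_orth_proj d (U : {vspace cochain d}) (x y : cochain d) : Prop :=
  y \in U /\ forall u, u \in U -> cochain_ip (x - y) u = 0.

Definition orth_proj d (U : {vspace cochain d}) (x : cochain d) : cochain d :=
  xget 0 (is_orth_proj U x).

Definition up_laplacian d : 'End(cochain d) :=
  (adjoint (coboundary d) \o coboundary d)%VF.

(* [down_laplacian d] and [laplacian d] act on C^(d+1). *)
Definition down_laplacian d : 'End(cochain d.+1) :=
  (coboundary d \o adjoint (coboundary d))%VF.

Definition laplacian d : 'End(cochain d.+1) :=
  up_laplacian d.+1 + down_laplacian d.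

Definition is_spectral_gap d (L : 'End(cochain d)) (lam : R) : Prop :=
  [/\ passmx.leigenvalue L lam, lam != 0 &
      forall mu : R, passmx.leigenvalue L mu -> mu != 0 -> lam <= mu].

(* The state space is the set of (n+1)-simplexes, i.e. N = n + 1. *)
Definition transition n (p : R) (s s' : simplex K n.+1) : R :=
  if s' == s then p
  else if share_face K n (val s) (val s') then (1 - p) / n.+2%:R
  else 0.

Definition walk_step n (p : R) (f : {ffun simplex K n.+1 -> R})
    : {ffun simplex K n.+1 -> R} :=
  [ffun s' => \sum_s transition p s s' * f s].

Definition point_mass n (s0 : simplex K n.+1) : {ffun simplex K n.+1 -> R} :=
  [ffun s => (s == s0)%:R].

(* The identification given by an orientation o: the cochain whose value at
   [o s] is f s (see [cochain_of_funE]). *)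
Definition cochain_of_fun d (o : simplex K d -> ordering V d)
    (f : {ffun simplex K d -> R}) : cochain d :=
  \sum_s f s *: elem (o s).

Definition walk_cochain n (o : simplex K n.+1 -> ordering V n.+1) (p : R)
    (s0 : simplex K n.+1) (t : nat) : cochain n.+1 :=
  cochain_of_fun o (iter t (walk_step p) (point_mass s0)).

End Cochains.

Notation cochain R K d := (subvs_of (cochain_space R K d)).

Section ComplexFacts.
Variable V : finType.
Implicit Types (K : {set {set V}}).

Lemma weight_recE K m m' (s : {set V}) : s \in K -> (#|V| - #|s| <= m)%N ->
  (#|V| - #|s| <= m')%N -> weight_rec K m s = weight_rec K m' s.
Proof.
have facetT t : t \in K -> (#|V| <= #|t|)%N -> facet K t.
  move=> tK le; rewrite /facet tK; apply/forall_inP => u _.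
  by apply/negP => /proper_card; rewrite ltnNge (leq_trans (max_card _)).
elim: m m' s => [|m IH] [|m'] s sK //=.
- by rewrite leqn0 subn_eq0 => le _; rewrite facetT.
- by rewrite leqn0 subn_eq0 => _ le; rewrite facetT.
move=> le le'; case: ifP => // _; apply: eq_bigr => t /and3P[tK _ /eqP ct].
by apply: IH => //; rewrite ct subnS -subn1 leq_subLR add1n.
Qed.

Lemma weightE K (s : {set V}) : s \in K ->
  weight K s = if facet K s then 1%N else
   (\sum_(t in K | (s \subset t) && (#|t| == #|s|.+1)) weight K t)%N.
Proof.
move=> sK; rewrite {1}/weight (@weight_recE _ _ (#|V| - #|s|).+1) //= .
case: ifP => // _; apply: eq_bigr => t /and3P[tK _ /eqP ct].
by apply: weight_recE => //; rewrite ct subnS leq_pred.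
Qed.

Lemma weight_gt0 K (s : {set V}) : simplicial_complex K -> s \in K -> (0 < weight K s)%N.
Proof.
move=> [K0 Kc].
have [k] := ubnP (#|V| - #|s|)%N; elim: k s => // k IH s lek sK.
rewrite weightE //; case: ifPn => //; rewrite /facet sK /= => /forall_inPn[t tK].
rewrite negbK => /properP[st [v vt vs]].
have c : #|v |: s|%SET = #|s|.+1 by rewrite cardsU1 vs.
have uK : (v |: s)%SET \in K.
  apply: (Kc t) => //; first by rewrite finset.subUset finset.sub1set vt.
  by rewrite -card_gt0 c.
rewrite (bigD1 (v |: s)%SET) /=; last by rewrite uK finset.subsetUr c eqxx.
rewrite addn_gt0 IH // c subnS.
have : (#|s|.+1 <= #|V|)%N by rewrite -c max_card.
rewrite -subn_gt0; move: lek; rewrite ltnS.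
by case: (#|V| - #|s|)%N.
Qed.

Lemma reorder_inj d (x : ordering V d) (s : 'S_d.+1) : injectiveb (reorder x s) = injectiveb x.
Proof.
apply/injectiveP/injectiveP => xi i j.
  move=> e; have := xi (s^-1 i)%g (s^-1 j)%g; rewrite !ffunE !permKV e.
  by move=> /(_ erefl) /perm_inj.
by rewrite !ffunE => /xi /perm_inj.
Qed.

Lemma vertices_reorder d (x : ordering V d) (s : 'S_d.+1) : vertices (reorder x s) = vertices x.
Proof.
apply/setP => v; apply/imsetP/imsetP => -[i _ ->].
  by exists (s i); rewrite ?ffunE.
by exists (s^-1 i)%g; rewrite ?ffunE ?permKV.
Qed.

Lemma oriented_reorder K d (x : ordering V d) (s : 'S_d.+1) :
  oriented K (reorder x s) = oriented K x.
Proof. by rewrite /oriented reorder_inj vertices_reorder. Qed.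

Lemma reorderM d (x : ordering V d) (s t : 'S_d.+1) :
  reorder (reorder x s) t = reorder x (t * s)%g.
Proof. by apply/ffunP => i; rewrite !ffunE permM. Qed.

Lemma reorder1 d (x : ordering V d) : reorder x 1%g = x.
Proof. by apply/ffunP => i; rewrite ffunE perm1. Qed.

Lemma osign_reorder d (x : ordering V d) (s : 'S_d.+1) : injectiveb x ->
  osign x (reorder x s) = (-1) ^+ s.
Proof.
move=> /injectiveP xi; rewrite /osign; case: pickP => [t|/(_ s)/[!eqxx]//].
move=> /eqP e; congr ((-1) ^+ odd_perm _); apply/permP => i.
by apply: xi; move/ffunP: e => /(_ i); rewrite !ffunE.
Qed.

Lemma osignr d (x y : ordering V d) (s : 'S_d.+1) : injectiveb x ->
  osign x (reorder y s) = (-1) ^+ s * osign x y.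
Proof.
move=> xi; case: (pickP [pred t | y == reorder x t]) => [t /eqP ->|n].
  by rewrite reorderM !osign_reorder // odd_permM signr_addb.
rewrite {2}/osign; case: pickP => [t|_]; first by have /= -> := n t.
rewrite /osign; case: pickP => [t|_]; last by rewrite mulr0.
move=> /eqP /(congr1 (fun z => reorder z s^-1)).
by rewrite !reorderM mulVg reorder1 => /eqP; have /= -> := n (s^-1 * t)%g.
Qed.

Lemma osignl d (x y : ordering V d) (s : 'S_d.+1) : injectiveb x ->
  osign (reorder x s) y = (-1) ^+ s * osign x y.
Proof.
move=> xi; case: (pickP [pred t | y == reorder x t]) => [t /eqP ->|n].
  have -> : reorder x t = reorder (reorder x s) (t * s^-1)%g.
    by rewrite reorderM mulgKV.
  rewrite osign_reorder ?reorder_inj // reorderM mulgKV osign_reorder //.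
  by rewrite odd_permM odd_permV addbC signr_addb.
rewrite {2}/osign; case: pickP => [t|_]; first by have /= -> := n t.
rewrite /osign; case: pickP => [t|_]; last by rewrite mulr0.
by rewrite reorderM; have /= -> := n (t * s)%g.
Qed.

Lemma orders_reorder d (x y : ordering V d) a :
  orders x a -> orders y a -> exists s, y = reorder x s.
Proof.
move=> /andP[/injectiveP xi /eqP vx] /andP[/injectiveP yi /eqP vy].
have h i : exists j, y i == x j.
  have : y i \in vertices x by rewrite vx -vy imset_f.
  by move=> /imsetP[j _ ->]; exists j.
have fi : injective (fun i => xchoose (h i)).
  move=> i j e; apply: yi.
  by rewrite (eqP (xchooseP (h i))) (eqP (xchooseP (h j))) e.
exists (perm fi); apply/ffunP => i; rewrite !ffunE permE.
exact/eqP/(xchooseP (h i)).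
Qed.

Lemma osign_orders d (x y : ordering V d) a b :
  orders x a -> orders y b -> a != b -> osign x y = 0.
Proof.
move=> /andP[xi /eqP vx] /andP[yi /eqP vy] ab.
rewrite /osign; case: pickP => // t /eqP e.
by move: ab; rewrite -vx -vy e vertices_reorder eqxx.
Qed.

Lemma std_ordP K d (s : simplex K d) : orders (std_ord s) (val s).
Proof.
apply/andP; split.
  by apply/injectiveP => i j; rewrite !ffunE => /enum_val_inj/cast_ord_inj.
apply/eqP/setP => v; apply/imsetP/idP => [[i _ ->]|vs].
  by rewrite ffunE enum_valP.
exists (cast_ord (esym (simplex_card s)) (enum_rank_in vs v)) => //.
by rewrite ffunE cast_ordKV enum_rankK_in.
Qed.

Lemma orders_oriented K d (s : simplex K d) (x : ordering V d) :
  orders x (val s) -> oriented K x.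
Proof.
move=> /andP[xi /eqP vx]; rewrite /oriented xi vx.
by case: (s) => u /= /[!inE] /andP[].
Qed.

Lemma orientedP K d (x : ordering V d) : oriented K x ->
  exists s : simplex K d, orders x (val s).
Proof.
move=> /andP[xi vK].
have h : vertices x \in simplexes K d.
  by rewrite inE vK card_imset ?card_ord //=; apply/injectiveP.
by exists (Sub (vertices x) h); rewrite /orders xi /=.
Qed.

Lemma face_reorder d (x : ordering V d.+1) (s : 'S_d.+2) j :
  exists t : 'S_d.+1, face j (reorder x s) = reorder (face (s j) x) t /\
    (s : bool) = odd j (+) odd (s j) (+) t.
Proof.
have h i : exists k, s (lift j i) == lift (s j) k.
  have : s j != s (lift j i) by rewrite (inj_eq perm_inj) neq_lift.
  by move=> /unlift_some[k -> _]; exists k.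
have [g gE] : exists g, forall i, s (lift j i) = lift (s j) (g i).
  by exists (fun i => xchoose (h i)) => i; apply/eqP/(xchooseP (h i)).
have gi : injective g.
  move=> i k e; apply: (@lift_inj _ j); apply: (@perm_inj _ s).
  by rewrite !gE e.
exists (perm gi).
have e : s = lift_perm j (s j) (perm gi).
  apply/permP => i; case: (unliftP j i) => [k ->|->]; last by rewrite lift_perm_id.
  by rewrite lift_perm_lift permE gE.
split; last by rewrite -odd_lift_perm -e.
by apply/ffunP => i; rewrite !ffunE permE gE.
Qed.

Lemma alt_faces (R : pzRingType) (W : lmodType R) d (G : ordering V d -> W) :
  (forall x s, G (reorder x s) = (-1) ^+ s *: G x) ->
  forall (x : ordering V d.+1) (s : 'S_d.+2),
  \sum_(j < d.+2) (-1) ^+ j *: G (face j (reorder x s)) =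
  (-1) ^+ s *: \sum_(j < d.+2) (-1) ^+ j *: G (face j x).
Proof.
move=> HG x s; rewrite (reindex_inj (@perm_inj _ s^-1)) /= scaler_sumr.
apply: eq_bigr => j _.
have [t [-> e]] := face_reorder x s (s^-1 j)%g.
rewrite permKV in e *; rewrite HG !scalerA; congr (_ *: _).
rewrite -signr_odd -(signr_odd _ j) -!signr_addb e; congr ((-1) ^+ nat_of_bool _).
by case: (odd j); case: (odd _); case: (odd_perm t).
Qed.
End ComplexFacts.

Section CochainFacts.
Variables (R : realType) (V : finType) (K : {set {set V}}).

Fact eval_at_linear d (x : ordering V d) :
  linear (@eval_at R V d x : pre_cochain R V d -> R^o).
Proof. by move=> a f g; rewrite /eval_at !ffunE. Qed.

Fact alt_defect_linear d (x : ordering V d) s :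
  linear (@alt_defect R V d x s : pre_cochain R V d -> R^o).
Proof.
move=> a f g; rewrite /alt_defect !ffunE mulrDr opprD scalerBr -!scalerAr.
by rewrite addrACA.
Qed.

HB.instance Definition _ d (x : ordering V d) :=
  GRing.isLinear.Build R (pre_cochain R V d) R^o *:%R (@eval_at R V d x)
    (eval_at_linear x).
HB.instance Definition _ d (x : ordering V d) s :=
  GRing.isLinear.Build R (pre_cochain R V d) R^o *:%R (@alt_defect R V d x s)
    (alt_defect_linear x s).

Lemma cochain_spaceP d (f : pre_cochain R V d) :
  f \in cochain_space R K d <->
  (forall x, ~~ oriented K x -> f x = 0) /\
  (forall x s, f (reorder x s) = (-1) ^+ s * f x).
Proof.
rewrite memv_cap; split.
  move=> /andP[/subv_bigcapP h1 /subv_bigcapP h2]; split.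
    move=> x /h1; rewrite -memvE memv_ker lfunE => /eqP; exact.
  move=> x s; move: (h2 x isT); move=> /subv_bigcapP /(_ s isT).
  by rewrite -memvE memv_ker lfunE /= subr_eq0 => /eqP.
move=> [h1 h2]; apply/andP; split; apply/subv_bigcapP => x hx.
  by rewrite -memvE memv_ker lfunE /= /eval_at h1.
apply/subv_bigcapP => s _.
by rewrite -memvE memv_ker lfunE /= /alt_defect h2 subrr.
Qed.

Lemma cochain_val_off d (f : cochain R K d) x :
  ~~ oriented K x -> cochain_val f x = 0.
Proof. have [h _] := (cochain_spaceP (vsval f)).1 (subvsP f); exact: h. Qed.

Lemma cochain_val_reorder d (f : cochain R K d) x s :
  cochain_val f (reorder x s) = (-1) ^+ s * cochain_val f x.
Proof. have [_ h] := (cochain_spaceP (vsval f)).1 (subvsP f); exact: h. Qed.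

Lemma cochain_valP d (f g : cochain R K d) :
  cochain_val f =1 cochain_val g -> f = g.
Proof. by move=> e; apply/val_inj/ffunP => x; exact: e. Qed.

Lemma linfunE_linear (U W : vectType R) (f : U -> W) :
  linear f -> linfun f =1 f.
Proof.
move=> lf; pose B := GRing.isLinear.Build R U W *:%R f lf.
pose F : {linear U -> W} := HB.pack f B.
by move=> u; rewrite -[f]/(F : U -> W) lfunE.
Qed.

Lemma pre_coboundary_mem d (f : cochain R K d) :
  pre_coboundary K (vsval f) \in cochain_space R K d.+1.
Proof.
apply/cochain_spaceP; split=> [x nx|x s]; first by rewrite ffunE (negbTE nx).
rewrite !ffunE oriented_reorder; case: ifP => _; last by rewrite mulr0.
exact: (alt_faces (W := R^o) (@cochain_val_reorder d f)).
Qed.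

Lemma coboundaryE d (f : cochain R K d) (x : ordering V d.+1) :
  cochain_val (coboundary R K d f) x =
  if oriented K x then \sum_(j < d.+2) (-1) ^+ j * cochain_val f (face j x)
  else 0.
Proof.
rewrite /cochain_val /coboundary linfunE_linear; last first.
  move=> a u v /=; rewrite -vsproj_is_linear; congr (vsproj _ _); apply/ffunP => y.
  rewrite !ffunE; case: ifP => _; last by rewrite scaler0 addr0.
  rewrite scaler_sumr -big_split; apply: eq_bigr => j _ /=.
  by rewrite !ffunE mulrDr -scalerAr.
by rewrite vsprojK ?ffunE // pre_coboundary_mem.
Qed.

Lemma pre_elem_mem d (x : ordering V d) : pre_elem R K x \in cochain_space R K d.
Proof.
apply/cochain_spaceP; split=> [y ny|y s]; rewrite !ffunE; last first.
  case: ifP => [/andP[xi _]|]; last by rewrite mulr0.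
  by rewrite osignr // rmorphM /= rmorphXn rmorphN1.
case: ifP => // /andP[xi xK].
case: (pickP [pred t | y == reorder x t]) => [t /eqP e|n].
  by move: ny; rewrite e oriented_reorder /oriented xi xK.
by rewrite /osign; case: pickP => // t; have /= -> := n t.
Qed.

Lemma elemE d (x y : ordering V d) :
  cochain_val (elem R K x) y = if oriented K x then (osign x y)%:~R else 0.
Proof. by rewrite /cochain_val /elem vsprojK ?pre_elem_mem // ffunE. Qed.

Lemma elem_reorder d (x : ordering V d) s :
  elem R K (reorder x s) = (-1) ^+ s *: elem R K x.
Proof.
apply: cochain_valP => y.
rewrite /cochain_val linearZ /= ffunE -!/(cochain_val _ _) !elemE oriented_reorder.
case: ifP => [/andP[xi _]|]; last by rewrite scaler0.
by rewrite osignl // rmorphM /= rmorphXn rmorphN1.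
Qed.

Lemma std_orientation d : orientation (@std_ord V K d).
Proof. by move=> s; exact: std_ordP. Qed.

Lemma osign_orientation d (o : simplex K d -> ordering V d) (s s' : simplex K d) :
  orientation o -> osign (o s) (o s') = (s == s')%:R.
Proof.
move=> ho; case: eqP => [<-|/eqP ns].
  by rewrite -[X in osign _ X]reorder1 osign_reorder ?odd_perm1 //; case/andP: (ho s).
by rewrite (osign_orders (ho s) (ho s')) // (inj_eq val_inj).
Qed.

Lemma cochain_valD d (f g : cochain R K d) x :
  cochain_val (f + g) x = cochain_val f x + cochain_val g x.
Proof. by rewrite /cochain_val linearD ffunE. Qed.
Lemma cochain_valZ d a (f : cochain R K d) x :
  cochain_val (a *: f) x = a * cochain_val f x.
Proof. by rewrite /cochain_val linearZ ffunE. Qed.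
Lemma cochain_val0 d x : cochain_val (0 : cochain R K d) x = 0.
Proof. by rewrite /cochain_val linear0 ffunE. Qed.
Lemma cochain_val_sum d I (r : seq I) (F : I -> cochain R K d) x :
  cochain_val (\sum_(i <- r) F i) x = \sum_(i <- r) cochain_val (F i) x.
Proof.
elim/big_rec2: _ => [|i y z _ e]; first exact: cochain_val0.
by rewrite cochain_valD e.
Qed.

Lemma cochain_of_funE d (o : simplex K d -> ordering V d)
    (f : {ffun simplex K d -> R}) (s : simplex K d) :
  orientation o -> cochain_val (cochain_of_fun o f) (o s) = f s.
Proof.
move=> ho; rewrite cochain_val_sum (bigD1 s) //= big1 ?addr0 => [|s' ns].
  by rewrite cochain_valZ elemE (orders_oriented (ho s)) osign_orientation // eqxx mulr1.
rewrite cochain_valZ elemE (orders_oriented (ho s')) osign_orientation //.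
by rewrite (negbTE ns) mulr0.
Qed.

Lemma cochain_eq_on d (o : simplex K d -> ordering V d) (f g : cochain R K d) :
  orientation o ->
  (forall s, cochain_val f (o s) = cochain_val g (o s)) -> f = g.
Proof.
move=> ho e; apply: cochain_valP => x.
have [/orientedP[s hs]|nx] := boolP (oriented K x); last first.
  by rewrite !cochain_val_off.
have [t ->] := orders_reorder (ho s) hs.
by rewrite !cochain_val_reorder e.
Qed.

Lemma cochain_decomp d (o : simplex K d -> ordering V d) (f : cochain R K d) :
  orientation o -> f = \sum_s cochain_val f (o s) *: elem R K (o s).
Proof.
move=> ho; apply: (cochain_eq_on ho) => s.
have := cochain_of_funE [ffun s => cochain_val f (o s)] s ho.
rewrite ffunE => <-; congr (cochain_val _ _).
by apply: eq_bigr => i _; rewrite ffunE.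
Qed.

Lemma boundary_elem d (x : ordering V d.+1) : oriented K x ->
  boundary R K d (elem R K x) = \sum_(j < d.+2) (-1) ^+ j *: elem R K (face j x).
Proof.
move=> ox; have [s hs] := orientedP ox.
rewrite /boundary linfunE_linear; last first.
  move=> a u v; rewrite scaler_sumr -big_split; apply: eq_bigr => t _ /=.
  by rewrite cochain_valD cochain_valZ scalerDl scalerA.
have [t e] := orders_reorder (std_ordP s) hs.
rewrite {2}e (alt_faces (@elem_reorder d)) (bigD1 s) //= [X in _ + X]big1 ?addr0 => [|s' ns].
  rewrite e elem_reorder cochain_valZ elemE (orders_oriented (std_ordP s)).
  by rewrite (osign_orientation _ _ (@std_orientation d.+1)) eqxx mulr1.
rewrite e elem_reorder cochain_valZ elemE (orders_oriented (std_ordP s)).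
by rewrite (osign_orientation _ _ (@std_orientation d.+1)) eq_sym (negbTE ns) mulr0 scale0r.
Qed.

Lemma cochain_ipE d (o : simplex K d -> ordering V d) (f g : cochain R K d) :
  orientation o -> cochain_ip f g = \sum_(s : simplex K d)
    (weight K (val s))%:R * cochain_val f (o s) * cochain_val g (o s).
Proof.
move=> ho; apply: eq_bigr => s _.
have [t ->] := orders_reorder (std_ordP s) (ho s).
by rewrite !cochain_val_reorder -!mulrA; congr (_ * _); rewrite [RHS]mulrCA signrMK.
Qed.

Lemma cochain_ipC d (f g : cochain R K d) : cochain_ip f g = cochain_ip g f.
Proof. by apply: eq_bigr => s _; rewrite mulrAC. Qed.

Lemma cochain_ipP d a (f g h : cochain R K d) :
  cochain_ip (a *: f + g) h = a * cochain_ip f h + cochain_ip g h.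
Proof.
rewrite /cochain_ip mulr_sumr -big_split; apply: eq_bigr => s _ /=.
by rewrite cochain_valD cochain_valZ mulrDr mulrDl !mulrA [_ * a]mulrC.
Qed.

Lemma cochain_ip_elem d (f : cochain R K d) (s : simplex K d) :
  cochain_ip (elem R K (std_ord s)) f =
  (weight K (val s))%:R * cochain_val f (std_ord s).
Proof.
have ho := @std_orientation d.
rewrite /cochain_ip (bigD1 s) //= big1 ?addr0 => [|s' ns].
  by rewrite elemE (orders_oriented (ho s)) osign_orientation // eqxx mulr1.
rewrite elemE (orders_oriented (ho s)) osign_orientation //.
by rewrite eq_sym (negbTE ns) mulr0 mul0r.
Qed.

Hypothesis hK : simplicial_complex K.

Lemma simplex_weight d (s : simplex K d) : 0 < (weight K (val s))%:R :> R.
Proof.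
rewrite ltr0n weight_gt0 //; by case: s => u /= /[!inE] /andP[].
Qed.

Lemma cochain_ip_ge0 d (f : cochain R K d) : 0 <= cochain_ip f f.
Proof.
apply: sumr_ge0 => s _; rewrite -mulrA; apply: mulr_ge0.
  exact/ltW/simplex_weight.
by rewrite -expr2 sqr_ge0.
Qed.

Lemma cochain_ip_eq0 d (f : cochain R K d) : cochain_ip f f = 0 -> f = 0.
Proof.
move=> h0; apply: (cochain_eq_on (@std_orientation d)) => s; rewrite cochain_val0.
have term_ge0 (t : simplex K d) : true -> 0 <= (weight K (val t))%:R *
    cochain_val f (std_ord t) * cochain_val f (std_ord t).
  move=> _; rewrite -mulrA; apply: mulr_ge0; first exact/ltW/simplex_weight.
  by rewrite -expr2 sqr_ge0.
have /eqP := psumr_eq0P term_ge0 h0 (i := s) isT.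
by rewrite -mulrA mulf_eq0 gt_eqF ?simplex_weight //= mulf_eq0 orbb => /eqP.
Qed.

Lemma adjointP d e (f : 'Hom(cochain R K d, cochain R K e)) :
  is_adjoint f (adjoint f).
Proof.
pose g (v : cochain R K e) : cochain R K d := \sum_(s : simplex K d)
  ((weight K (val s))%:R^-1 * cochain_ip (f (elem R K (std_ord s))) v) *:
    elem R K (std_ord s).
have lg : linear g.
  move=> a u v; rewrite /g scaler_sumr -big_split; apply: eq_bigr => s _ /=.
  by rewrite !(cochain_ipC (f _)) cochain_ipP scalerA -scalerDl mulrDr mulrCA.
suff h : is_adjoint f (linfun g) by exact: xgetPex (ex_intro _ _ h).
move=> u v; rewrite linfunE_linear //.
have ip_suml d' I (r : seq I) (c : I -> R) (F : I -> cochain R K d') w :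
    cochain_ip (\sum_(i <- r) c i *: F i) w =
    \sum_(i <- r) c i * cochain_ip (F i) w.
  elim/big_rec2: _ => [|i y z _ <-]; last by rewrite cochain_ipP.
  by rewrite /cochain_ip big1 // => s _; rewrite cochain_val0 mulr0 mul0r.
rewrite {1}(cochain_decomp u (@std_orientation d)) linear_sum /=.
rewrite (eq_bigr (fun s => cochain_val u (std_ord s) *: f (elem R K (std_ord s)))); last first.
  by move=> s _; rewrite linearZ.
rewrite ip_suml [RHS]cochain_ipC ip_suml; apply: eq_bigr => s _.
rewrite cochain_ip_elem mulrACA mulVf ?gt_eqF ?simplex_weight //.
by rewrite mul1r mulrC.
Qed.

Lemma orth_projP d (U : {vspace cochain R K d}) x :
  is_orth_proj U x (orth_proj U x).
Proof.
suff h : exists y, is_orth_proj U x y by exact: xgetPex h.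
pose F (u : subvs_of U) : 'rV[R]_(\dim U) :=
  \row_i cochain_ip (vsval u) (vbasis U)`_i.
have lF : linear F.
  by move=> a u v; apply/rowP => i; rewrite !mxE linearP cochain_ipP.
have orthb z : (forall i : 'I_(\dim U), cochain_ip z (vbasis U)`_i = 0) ->
    forall u, u \in U -> cochain_ip z u = 0.
  move=> hz u uU; rewrite (coord_vbasis uU) cochain_ipC.
  elim/big_rec: _ => [|i y _ e].
    by rewrite /cochain_ip big1 // => s _; rewrite cochain_val0 mulr0 mul0r.
  by rewrite cochain_ipP e addr0 cochain_ipC hz mulr0.
have kF : lker (linfun F) == 0%VS.
  rewrite -subv0; apply/subvP => u; rewrite memv_ker memv0 linfunE_linear //.
  move=> /eqP Fu; apply/eqP/val_inj/cochain_ip_eq0/orthb; last exact: subvsP.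
  by move=> i; move/rowP: Fu => /(_ i); rewrite !mxE.
have full : limg (linfun F) = fullv.
  apply/eqP; rewrite eqEdim subvf limg_dim_eq; last by rewrite (eqP kF) capv0.
  by rewrite !dimvf /dim /= mul1n.
have : \row_i cochain_ip x (vbasis U)`_i \in limg (linfun F).
  by rewrite full memvf.
move=> /memv_imgP[u _]; rewrite linfunE_linear // => e.
exists (vsval u); split; first exact: subvsP.
apply: orthb => i; move/rowP: e => /(_ i); rewrite !mxE => e.
by rewrite addrC -scaleN1r cochain_ipP e mulN1r addNr.
Qed.

Lemma orth_proj_uniq d (U : {vspace cochain R K d}) x y :
  is_orth_proj U x y -> y = orth_proj U x.
Proof.
move=> [yU hy]; have [zU hz] := orth_projP U x.
apply/eqP; rewrite -subr_eq0; apply/eqP/cochain_ip_eq0.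
have dU : y - orth_proj U x \in U by rewrite memvB.
rewrite -{1}[y](subrK x) -addrA -[y - x]opprB -scaleN1r cochain_ipP.
by rewrite hy // hz // mulr0 addr0.
Qed.

Lemma adjoint_uniq d e (f : 'Hom(cochain R K d, cochain R K e)) g :
  is_adjoint f g -> g = adjoint f.
Proof.
move=> hg; apply/lfunP => v; apply/eqP; rewrite -subr_eq0; apply/eqP/cochain_ip_eq0.
set w := _ - _; rewrite {1}/w addrC -scaleN1r cochain_ipP.
by rewrite !(cochain_ipC _ w) -(adjointP f) -hg mulN1r addNr.
Qed.

End CochainFacts.

(* Main.v *)
Require Import Defs.
From mathcomp Require Import all_boot all_order all_fingroup all_algebra.
From mathcomp Require Import all_classical all_reals all_analysis.
From mathcomp Require Import complex ring lra.
Import Order.TTheory GRing.Theory Num.Theory.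
Import numFieldNormedType.Exports.

Local Open Scope ring_scope.

Set Implicit Arguments.
Unset Strict Implicit.
Unset Printing Implicit Defensive.

(** In top dimension every weight is 1, and every ridge (an n-simplex, i.e. an
    (N-1)-simplex with N = n + 1) has weight 2, so the adjoint of the
    coboundary is half the boundary ([adjoint_coboundary]).  A ridge of an
    N-simplex s lies in exactly one other N-simplex s', and a coherent
    orientation gives it opposite incidences with s and s'.  Hence, on
    functions of the N-simplexes, the down Laplacian is half the graph
    Laplacian of the adjacency graph ([down_laplacianE]):
      (D f)(s) = 1/2 \sum_(s' adjacent to s) (f s - f s').
    This graph is (N+1)-regular ([card_neighbors]), so a step of the walk is
    the operator 1 - k D with k = 2 (1 - p) / (N + 1) ([walk_stepE]).

    As D is self-adjoint, the initial point mass x splits into orthogonal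
    eigenvectors x_a ([eigen_decomposition]), and after t steps x_a has been
    multiplied by (1 - k a)^t.  The component x_0, which is the orthogonal
    projection of x to the kernel, is fixed; so if |1 - k a| <= rho for all
    nonzero eigenvalues a, then the distance to x_0 is at most rho^t times the
    norm of x ([iterates_near_kernel], [dis_walk_le]).

    It remains to locate the spectrum.  The energy identity
    [neighbor_energy], applied to the sums of f s - f s' and of f s + f s',
    gives 0 <= a <= N + 1 ([down_eigenvalue_bounds]).  Thus 0 <= k a / 2 <= 1 - p,
    and 0 < p < 1 forces |1 - k a| < 1 for a != 0.  For p = 0 the only
    obstruction is a = N + 1; the energy identity makes its eigenvectors f change sign
    along every adjacency, and reversing the orientation where f < 0 disorients
    a component ([top_eigenvector_disorientable]).  For p >= 1/2 all the numbers
    1 - k a are nonnegative, so the largest one with a != 0 is attained at the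
    spectral gap ([gap_rate]).

    In the same way, a cochain of the kernel is constant on N-connected
    components, so the limit depends only on the component of the starting
    point.  Finally, there are no (N+1)-simplexes, so homology in dimension N
    is the kernel of the boundary, which is that of the adjoint. *)

(** * Diagonalization of self-adjoint operators *)

(** The complex spectral theorem applies to A seen as a hermitian matrix, and
    its eigenvalues are real.  Minimal polynomials do not change under field
    extension, so that of A is already a product of distinct linear factors
    over R. *)
Lemma symmetric_diagonalizable (R : rcfType) m (A : 'M[R]_m) :
  A^T = A -> exists2 r : seq R, uniq r &
    (\sum_(a <- r) eigenspace A a :=: 1%:M)%MS.
Proof.
case: m A => [|m] A sA.
  by exists [::] => //; apply/eqmxP; rewrite big_nil !thinmx0 !sub0mx.
suff /diagonalizablePeigen : diagonalizable A by [].
pose f := real_complex R.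
pose B := map_mx f A.
have rB : B \is a mxOver Num.real.
  by apply/mxOverP => i j; rewrite mxE; apply/complex_realP; exists (A i j).
have sB : B \is symmetricmx.
  by apply/is_hermitianmxP; rewrite expr0 scale1r map_mx_id // /B map_trmx sA.
have hB := realsym_hermsym sB rB.
have /orthomx_spectralP eB := hermitian_normalmx hB.
have /mxOverP rd := hermitian_spectral_diag_real hB.
have uP := spectral_unit B.
set d := spectral_diag B in eB rd.
have : mxminpoly B = map_poly f (mxminpoly A) by rewrite mxminpoly_map.
rewrite eB -conjVmx // mxminpoly_uconj ?unitmx_inv // mxminpoly_diag => eq_min.
pose s := [seq complex.Re (d 0 i) | i <- enum 'I_m.+1].
have es : [seq d 0 i | i <- enum 'I_m.+1] = map f s.
  rewrite /s; elim: (enum _) => //= i l ->; congr (_ :: _).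
  by rewrite /f RRe_real.
apply/diagonalizableP; exists (undup s); first exact: undup_uniq.
rewrite -(dvdp_map f) -eq_min es undup_map_inj; last exact: complexI.
rewrite big_map rmorph_prod; under [X in _ %| X]eq_bigr do rewrite /= map_polyXsubC.
exact: dvdpp.
Qed.

Lemma leigenvalueP (R : fieldType) (E : vectType R) (T : 'End(E)) (a : R) :
  reflect (exists2 x, x != 0 & T x = a *: x) (passmx.leigenvalue T a).
Proof.
have kerE x : (x \in passmx.leigenspace T a) = (T x == a *: x).
  by rewrite memv_ker add_lfunE opp_lfunE scale_lfunE id_lfunE subr_eq0.
apply: (iffP idP) => [|[x x0 Tx]].
  rewrite /passmx.leigenvalue -vpick0 => h.
  by exists (vpick (passmx.leigenspace T a)) => //; apply/eqP; rewrite -kerE memv_pick.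
rewrite /passmx.leigenvalue; apply/eqP => h.
have : x \in passmx.leigenspace T a by rewrite kerE Tx.
by rewrite h memv0 (negbTE x0).
Qed.

(** As r has no duplicates, the summands can be indexed by a itself instead of
    its position in r; [eigen_decomposition] can then speak of the component
    for the eigenvalue a. *)
Lemma sub_sum_choice (R : fieldType) m (I : eqType) (V : I -> 'M[R]_m)
    (r : seq I) (v : 'rV[R]_m) :
  uniq r -> (v <= \sum_(a <- r) V a)%MS ->
  exists2 w : I -> 'rV[R]_m,
    v = \sum_(a <- r) w a & forall a, a \in r -> (w a <= V a)%MS.
Proof.
elim: r v => [|a r IH] v /=.
  by rewrite big_nil submx0 => _ /eqP ->; exists (fun=> 0); rewrite ?big_nil.
move=> /andP[ar ur]; rewrite big_cons => /sub_addsmxP[u ->].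
have [w ew wV] := IH _ ur (submxMl u.2 _).
exists (fun b => if b == a then u.1 *m V a else w b) => [|b]; last first.
  by rewrite inE; case: eqP => [-> _|_ /wV//]; apply: submxMl.
rewrite big_cons eqxx ew; congr (_ + _); apply: eq_big_seq => b br.
by case: eqP => // eab; rewrite -eab br in ar.
Qed.

Section SelfAdjoint.
Variables (R : rcfType) (E : vectType R) (ip : E -> E -> R).
Hypothesis ipC : forall x y, ip x y = ip y x.
Hypothesis ipP : forall a x y z, ip (a *: x + y) z = a * ip x z + ip y z.
Hypothesis ip_ge0 : forall x, 0 <= ip x x.
Hypothesis ip_eq0 : forall x, ip x x = 0 -> x = 0.
Variables (m : nat) (e : 'I_m -> E).
(* An orthonormal basis satisfies this; its effect is that the Gram matrix of T
   in [eigen_decomposition] represents T. *)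
Hypothesis e_expand : forall x, x = \sum_i ip x (e i) *: e i.
Variable T : 'End(E).
Hypothesis T_self_adjoint : forall x y, ip (T x) y = ip x (T y).

Lemma ip0 x : ip 0 x = 0.
Proof. by have := ipP (-1) 0 0 x; rewrite scaler0 addr0 mulN1r addNr. Qed.

Lemma ip_suml I (r : seq I) (P : pred I) (k : I -> R) (f : I -> E) y :
  ip (\sum_(i <- r | P i) k i *: f i) y = \sum_(i <- r | P i) k i * ip (f i) y.
Proof. by elim/big_rec2: _ => [|i z w _ <-]; rewrite ?ip0 ?ipP. Qed.

Lemma eigenvector_orthogonal a b x y :
  T x = a *: x -> T y = b *: y -> a != b -> ip x y = 0.
Proof.
move=> Tx Ty; apply: contraNeq => xy.
have ipZ k u v : ip (k *: u) v = k * ip u v by rewrite -[_ *: _]addr0 ipP ip0 addr0.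
have := T_self_adjoint x y; rewrite Tx Ty ipZ (ipC x (_ *: _)) ipZ (ipC y).
by move/(mulIf xy) => ->.
Qed.

(** In the coordinates given by e, the operator T is a symmetric matrix. *)
Lemma eigen_decomposition : exists2 r : seq R, uniq r &
  forall x, exists2 c : R -> E,
    x = \sum_(a <- r) c a & forall a, a \in r -> T (c a) = a *: c a.
Proof.
pose A : 'M[R]_m := \matrix_(i, j) ip (T (e i)) (e j).
have sA : A^T = A.
  by apply/matrixP => i j; rewrite !mxE T_self_adjoint ipC.
pose vec (u : 'rV[R]_m) : E := \sum_i u 0 i *: e i.
have vecA u : T (vec u) = vec (u *m A).
  rewrite linear_sum /=; under eq_bigr do rewrite linearZ /= [T _]e_expand scaler_sumr.
  rewrite exchange_big; apply: eq_bigr => j _ /=; rewrite mxE scaler_suml.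
  by apply: eq_bigr => i _; rewrite mxE scalerA.
have [r ur dec] := symmetric_diagonalizable sA; exists r => // x.
have : (\row_i ip x (e i) <= \sum_(a <- r) eigenspace A a)%MS by rewrite dec submx1.
move=> /(sub_sum_choice ur)[w ew wA]; exists (fun a => vec (w a)) => [|a ar]; last first.
  rewrite vecA (eigenspaceP (wA a ar)) /vec scaler_sumr.
  by under eq_bigr do rewrite mxE -scalerA.
rewrite {1}[x]e_expand /vec exchange_big; apply: eq_bigr => i _ /=.
by rewrite -scaler_suml; have /rowP/(_ i) := ew; rewrite !mxE summxE => ->.
Qed.

(** Eigenvectors for different eigenvalues are orthogonal. *)
Lemma parseval r (c : R -> E) (k : R -> R) : uniq r ->
  (forall a, a \in r -> T (c a) = a *: c a) ->
  ip (\sum_(a <- r) k a *: c a) (\sum_(a <- r) k a *: c a) =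
  \sum_(a <- r) k a ^+ 2 * ip (c a) (c a).
Proof.
move=> ur Tc; rewrite ip_suml; apply: eq_big_seq => a ar.
rewrite ipC ip_suml (bigD1_seq a) //= big_seq_cond big1 => [|b /andP[br ba]].
  by rewrite addr0 mulrA expr2.
by rewrite (eigenvector_orthogonal (Tc b br) (Tc a ar) ba) mulr0.
Qed.

(** An eigenvector whose eigenvalue does not occur in the decomposition would
    be orthogonal to all its components, hence to itself. *)
Lemma finitely_many_eigenvalues :
  exists r : seq R, forall a, passmx.leigenvalue T a -> a \in r.
Proof.
have [r _ dec] := eigen_decomposition; exists r => a /leigenvalueP[x x0 Tx].
have [c ex Tc] := dec x; apply: contraNT x0 => ar; apply/eqP/ip_eq0.
have {1}-> : x = \sum_(b <- r) 1 *: c b by under eq_bigr do rewrite scale1r.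
rewrite ip_suml big_seq big1 // => b br.
rewrite (eigenvector_orthogonal (Tc b br) Tx) ?mulr0 //.
by apply: contraNneq ar => <-.
Qed.

Lemma spectral_gap_exists : T != 0 ->
  exists lam, [/\ passmx.leigenvalue T lam, lam != 0 &
    forall mu, passmx.leigenvalue T mu -> mu != 0 -> lam <= mu].
Proof.
move=> T0; have [r hr] := finitely_many_eigenvalues.
pose s := [seq a <- r | passmx.leigenvalue T a && (a != 0)].
have inS a : passmx.leigenvalue T a -> a != 0 -> a \in s.
  by move=> ha a0; rewrite mem_filter ha a0 hr.
have sP a : a \in s -> passmx.leigenvalue T a /\ a != 0.
  by rewrite mem_filter => /andP[/andP[]].
have s0 : s != [::].
  apply: contraNneq T0 => s0; apply/eqP/lfunP => x; rewrite zero_lfunE.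
  have [q _ dec] := eigen_decomposition.
  have [c -> Tc] := dec x; rewrite linear_sum big_seq big1 // => a aq /=.
  rewrite Tc //; have [->|a0] := eqVneq a 0; first by rewrite scale0r.
  have [->|c0] := eqVneq (c a) 0; first by rewrite scaler0.
  suff : a \in s by rewrite s0.
  by apply: inS => //; apply/leigenvalueP; exists (c a) => //; exact: Tc.
have sort0 : sort <=%R s != [::] by rewrite -size_eq0 size_sort size_eq0.
case es : (sort <=%R s) sort0 => [//|lam s'] _.
have lams : lam \in s by rewrite -(mem_sort <=%R) es mem_head.
have [? ?] := sP _ lams; exists lam; split=> // mu hmu mu0.
have : mu \in sort <=%R s by rewrite mem_sort inS.
rewrite es inE => /orP[/eqP -> //|mus'].
have := sort_le_sorted s; rewrite es /= (path_sortedE le_trans).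
by move=> /andP[/allP /(_ _ mus')].
Qed.

(** With finitely many eigenvalues, strict contraction on each of them is
    contraction at a common rate. *)
Lemma eigenvalue_rate (k : R) :
  (forall a, passmx.leigenvalue T a -> a != 0 -> `|1 - k * a| < 1) ->
  exists rho, 0 <= rho < 1 /\
    forall a, passmx.leigenvalue T a -> a != 0 -> `|1 - k * a| <= rho.
Proof.
move=> hk; have [r hr] := finitely_many_eigenvalues.
exists (\big[Num.max/0]_(a <- r | passmx.leigenvalue T a && (a != 0)) `|1 - k * a|).
split=> [|a ha a0].
  rewrite bigmax_ge_id /=; apply: bigmax_lt => // a /andP[]; exact: hk.
rewrite (le_bigmax_seq _ a _ (fun b => `|1 - k * b|)) ?hr ?ha //.
Qed.

(** After t steps of z |-> z - k T z the component of x for the eigenvalue a has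
    been multiplied by (1 - k a)^t.  The component for 0 never moves: it is the
    projection of x to the kernel and the candidate limit. *)
Lemma iterates_near_kernel (x : E) : exists x0 : E,
  [/\ T x0 = 0, forall u, T u = 0 -> ip (x - x0) u = 0 &
   forall k rho : R,
     (forall a, passmx.leigenvalue T a -> a != 0 -> `|1 - k * a| <= rho) ->
     forall t, let y := iter t (fun z => z - k *: T z) x - x0 in
       ip y y <= rho ^+ t ^+ 2 * ip x x].
Proof.
have [r ur dec] := eigen_decomposition; have [c ex Tc] := dec x.
pose comb (f : R -> R) := \sum_(a <- r) f a *: c a.
have combB f g : comb f - comb g = comb (fun a => f a - g a).
  by rewrite /comb -sumrB; apply: eq_bigr => a _; rewrite scalerBl.
have Tcomb f : T (comb f) = comb (fun a => f a * a).
  rewrite linear_sum /=; apply: eq_big_seq => a ar.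
  by rewrite linearZ /= Tc // scalerA.
have xE : x = comb (fun=> 1) by rewrite ex; apply: eq_bigr => a _; rewrite scale1r.
have iterE k t : iter t (fun z => z - k *: T z) x = comb (fun a => (1 - k * a) ^+ t).
  elim: t => [|t IH] //=; rewrite IH Tcomb {2}/comb scaler_sumr -/(comb _).
  rewrite /comb -sumrB; apply: eq_bigr => a _.
  by rewrite scalerA -scalerBl exprS mulrBl mul1r -(mulrA k a) [a * _]mulrC.
exists (comb (fun a => (a == 0)%:R)); split=> [|u Tu|k rho hrho t /=].
- by rewrite Tcomb /comb big1 // => a _; case: eqP => [->|_]; rewrite ?mulr0 ?mul0r scale0r.
- rewrite {1}xE combB ip_suml big_seq big1 // => a ar.
  have [->|a0] := eqVneq a 0; first by rewrite subrr mul0r.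
  rewrite (@eigenvector_orthogonal a 0 _ _ (Tc a ar)) ?mulr0 //.
  by rewrite scale0r.
- rewrite iterE combB xE !parseval // mulr_sumr !big_seq.
  apply: ler_sum => a ar; rewrite expr1n mul1r.
  have [->|c0] := eqVneq (c a) 0; first by rewrite ip0 !mulr0.
  apply: ler_wpM2r => //.
  have [->|a0] := eqVneq a 0.
    by rewrite mulr0 subr0 expr1n subrr expr0n /= sqr_ge0.
  rewrite subr0 -(real_normK (num_real _)) normrX.
  have h : `|1 - k * a| <= rho.
    by apply: hrho => //; apply/leigenvalueP; exists (c a) => //; exact: Tc.
  by rewrite ler_sqr ?nnegrE ?exprn_ge0 ?(le_trans _ h) // lerXn2r ?nnegrE ?(le_trans _ h).
Qed.

End SelfAdjoint.

(** * Incidence of simplexes with their faces *)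

Section Faces.
Variable V : finType.
Implicit Types (K : {set {set V}}) (s t : {set V}).

Lemma face_inj d (x : ordering V d.+1) j : injectiveb x -> injectiveb (face j x).
Proof.
move=> /injectiveP xi; apply/injectiveP => i k; rewrite !ffunE => /xi.
exact: lift_inj.
Qed.

Lemma vertices_face d (x : ordering V d.+1) j : injectiveb x ->
  vertices (face j x) = (vertices x :\ x j)%SET.
Proof.
move=> /injectiveP xi; apply/setP => v; rewrite !inE; apply/imsetP/andP.
  move=> [i _ ->]; rewrite ffunE (inj_eq xi) eq_sym neq_lift; split=> //.
  exact: imset_f.
move=> [vj /imsetP[i _ e]]; move: vj; rewrite e (inj_eq xi) eq_sym.
by move=> /unlift_some[k -> _]; exists k; rewrite ?ffunE.
Qed.

Lemma card_vertices d (x : ordering V d) : injectiveb x -> #|vertices x| = d.+1.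
Proof. by move=> /injectiveP xi; rewrite card_imset ?card_ord. Qed.

Lemma face_oriented K d (x : ordering V d.+1) j : simplicial_complex K ->
  oriented K x -> oriented K (face j x).
Proof.
move=> [_ hK] /andP[xi xK]; rewrite /oriented face_inj //=.
apply: hK xK _ _; first by rewrite vertices_face // subsetDl.
by rewrite -card_gt0 card_vertices // face_inj.
Qed.

Lemma osignC d (x y : ordering V d) : injectiveb x -> injectiveb y -> osign x y = osign y x.
Proof.
move=> xi yi; rewrite {1}/osign; case: pickP => [s /eqP e|h].
  have -> : x = reorder y s^-1%g by rewrite e reorderM mulVg reorder1.
  by rewrite osign_reorder // odd_permV.
rewrite /osign; case: pickP => // s /eqP e.
by have := h s^-1%g; rewrite e reorderM mulVg reorder1 eqxx.
Qed.

Lemma osign_vertices d (x y : ordering V d) : vertices x != vertices y -> osign x y = 0.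
Proof.
move=> h; rewrite /osign; case: pickP => // s /eqP e.
by rewrite e vertices_reorder eqxx in h.
Qed.

Lemma osignxx d (x : ordering V d) : injectiveb x -> osign x x = 1.
Proof. by move=> xi; rewrite -{2}[x]reorder1 osign_reorder ?odd_perm1. Qed.

Lemma face_vertices_inj d (x : ordering V d.+1) i j : injectiveb x ->
  vertices (face i x) = vertices (face j x) -> i = j.
Proof.
move=> xi /setP/(_ (x j)); rewrite !vertices_face // !inE eqxx imset_f // andbT.
by move=> /negbFE/eqP; move/injectiveP: xi => xi /xi.
Qed.

Lemma incidence_face d (x : ordering V d.+1) j : injectiveb x ->
  incidence x (face j x) = (-1) ^+ j.
Proof.
move=> xi; rewrite /incidence (bigD1 j) //= osignxx ?face_inj // mulr1.
rewrite big1 ?addr0 // => i ij; rewrite osign_vertices ?mulr0 //.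
by apply: contraNneq ij => /face_vertices_inj ->.
Qed.

Lemma incidence_nface d (x : ordering V d.+1) (y : ordering V d) : injectiveb x ->
  ~~ (vertices y \subset vertices x) -> incidence x y = 0.
Proof.
move=> xi h; rewrite /incidence big1 // => i _; rewrite osign_vertices ?mulr0 //.
by apply: contraNneq h => <-; rewrite vertices_face // subsetDl.
Qed.

(** Off the injective orderings [osign] need not be alternating: they are set to
    0 so that [alt_faces] applies. *)
Lemma incidence_reorder d (x : ordering V d.+1) (s : 'S_d.+2) y : injectiveb x ->
  incidence (reorder x s) y = (-1) ^+ s * incidence x y.
Proof.
move=> xi; pose G (z : ordering V d) : int^o := if injectiveb z then osign z y else 0.
have GE (z : ordering V d.+1) i : injectiveb z -> osign (face i z) y = G (face i z).
  by move=> zi; rewrite /G face_inj.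
have G_alt (z : ordering V d) (t : 'S_d.+1) : G (reorder z t) = (-1) ^+ t *: G z.
  by rewrite /G reorder_inj; case: ifP => [zi|_]; rewrite ?osignl // scaler0.
rewrite /incidence; under eq_bigr do rewrite GE ?reorder_inj //.
under [in RHS]eq_bigr do rewrite GE //.
exact: (alt_faces G_alt).
Qed.

(** Two faces of s that lie in s' have union s, so two simplexes of the same
    dimension share at most one of them. *)
Lemma faces_in_other d (x : ordering V d.+1) K s s' : orders x s -> s \in K ->
  simplicial_complex K -> #|s'| = d.+2 -> s != s' ->
  #|[set j | vertices (face j x) \subset s']%SET| = share_face K d s s'.
Proof.
move=> /andP[xi /eqP vx] sK hK cs' ss'.
have cs : #|s| = d.+2 by rewrite -vx card_vertices.
have fs j : vertices (face j x) \subset s by rewrite vertices_face // vx subsetDl.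
have uniq_face i j : vertices (face i x) \subset s' ->
    vertices (face j x) \subset s' -> i = j.
  move=> hi hj; apply: contraNeq ss' => ij.
  rewrite eqEcard cs cs' leqnn andbT; apply/fintype.subsetP => v.
  rewrite -vx => vs; have [ev|vj] := eqVneq v (x j); last first.
    by apply: (fintype.subsetP hj); rewrite vertices_face // !inE vj.
  apply: (fintype.subsetP hi); rewrite vertices_face // !inE vs andbT ev.
  by move/injectiveP: xi => /inj_eq ->; rewrite eq_sym.
have [/existsP[t /and3P[tK ts ts']]|/existsPn hn] := boolP (share_face K d s s').
  have [j ej] : exists j, vertices (face j x) = t.
    move: tK; rewrite inE => /andP[_ /eqP ct].
    have /eqP/cards1P[v ev] : #|s :\: t|%SET = 1%N.
      by rewrite cardsD (finset.setIidPr ts) cs ct subSnn.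
    have : v \in (s :\: t)%SET by rewrite ev finset.set11.
    rewrite inE -vx => /andP[vt /imsetP[j _ vj]]; exists j.
    rewrite vertices_face // vx -vj -ev; apply/setP => w; rewrite !inE.
    by case: (boolP (w \in t)) => [/(fintype.subsetP ts) ->|_]//=; case: (w \in s).
  apply/eqP/cards1P; exists j; apply/setP => i; rewrite !inE.
  by apply/idP/eqP => [hi|->]; [apply: uniq_face => //|]; rewrite ej.
apply/eqP; rewrite cards_eq0; apply/eqP/setP => j; rewrite !inE.
apply/negbTE; have := hn (vertices (face j x)); rewrite negb_and => /orP[|/nandP[]//].
  have := face_oriented (K := K) (x := x) j hK.
  rewrite /oriented xi vx sK inE => /(_ isT) /andP[fi ->].
  by rewrite card_vertices // eqxx.
by rewrite fs.
Qed.

End Faces.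

(** * Dirichlet energy of a graph *)

Section NeighborEnergy.
Variables (R : realDomainType) (S : finType) (adj : rel S) (eps : R) (g : S -> R).
Hypothesis adjC : symmetric adj.
Hypothesis eps2 : eps ^+ 2 = 1.

(** Each unordered pair of neighbors contributes from both of its ends.  The
    sign eps = -1 gives the energy of the graph Laplacian, and eps = 1 that of
    the signless Laplacian, which controls the other end of the spectrum. *)
Lemma neighbor_energy :
  (\sum_s (\sum_(s' | adj s s') (g s + eps * g s')) * g s) *+ 2 =
  \sum_s \sum_(s' | adj s s') (g s + eps * g s') ^+ 2.
Proof.
under eq_bigr do rewrite mulr_suml.
rewrite mulr2n {2}(exchange_big_dep xpredT) //= -big_split; apply: eq_bigr => s _ /=.
under [X in _ + X]eq_bigl do rewrite adjC.
rewrite -big_split; apply: eq_bigr => s' _ /=.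
by rewrite sqrrD exprMn eps2; ring.
Qed.

Lemma neighbor_energy_eigen b : (exists s, g s != 0) ->
  (forall s, \sum_(s' | adj s s') (g s + eps * g s') = b * g s) -> 0 <= b.
Proof.
move=> [s gs] hb.
have G0 : 0 < \sum_t g t ^+ 2.
  rewrite (bigD1 s) //= ltr_pwDl ?sumr_ge0 // => [|t _]; last exact: sqr_ge0.
  by rewrite lt_def sqrf_eq0 gs sqr_ge0.
have : 0 <= (\sum_s (\sum_(s' | adj s s') (g s + eps * g s')) * g s) *+ 2.
  by rewrite neighbor_energy; do 2!apply: sumr_ge0 => ? _; exact: sqr_ge0.
rewrite pmulrn_lge0 //; under eq_bigr do rewrite hb -mulrA -expr2.
by rewrite -mulr_sumr pmulr_lge0.
Qed.

Lemma neighbor_energy0 : (forall s, \sum_(s' | adj s s') (g s + eps * g s') = 0) ->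
  forall s s', adj s s' -> g s = - (eps * g s').
Proof.
move=> h0 s s' ss'; apply/eqP; rewrite -addr_eq0 -sqrf_eq0; apply/eqP.
have := neighbor_energy; rewrite big1 ?mul0rn => [|t _]; last by rewrite h0 mul0r.
have sq_ge0 t (P : pred S) : 0 <= \sum_(t' | P t') (g t + eps * g t') ^+ 2.
  by apply: sumr_ge0 => ? _; exact: sqr_ge0.
move=> /esym /(psumr_eq0P (fun t _ => sq_ge0 t _)) /(_ s isT).
by move=> /(psumr_eq0P (fun t _ => sqr_ge0 _)) ->.
Qed.

End NeighborEnergy.

(** * The down Laplacian of a closed coherently oriented complex *)

Section ClosedComplex.
Variables (R : realType) (V : finType) (K : {set {set V}}) (n : nat).
Variable o : simplex K n.+1 -> ordering V n.+1.
Hypothesis hK : simplicial_complex K.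
Hypothesis hdim : dim_complex K n.+1.
Hypothesis hdeg : forall t, t \in simplexes K n -> coface_degree K n t = 2%N.
Hypothesis ho : coherent o.

Local Notation S := (simplex K n.+1).
Local Notation C := (cochain R K n.+1).
Local Notation D := (down_laplacian R K n).

Implicit Types (s : S) (f : C).

Lemma simplex_mem d (s : simplex K d) : val s \in K.
Proof. by case: s => u /= /[!inE] /andP[]. Qed.

Let o_orient : orientation o := ho.1.

Lemma o_inj s : injectiveb (o s).
Proof. by have /andP[] := o_orient s. Qed.

Lemma o_vertices s : vertices (o s) = val s.
Proof. by have /andP[_ /eqP] := o_orient s. Qed.

Lemma weight_top s : weight K (val s) = 1%N.
Proof.
rewrite weightE ?simplex_mem // ifT // /facet simplex_mem.
apply/forall_inP => t tK; apply/negP => /proper_card.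
by rewrite -simplex_card ltnNge (hdim.2 _ tK).
Qed.

Lemma weight_ridge (t : simplex K n) : weight K (val t) = 2%N.
Proof.
have h := hdeg (valP t); rewrite weightE ?simplex_mem //.
have cof u : (u \in [set s in simplexes K n.+1 | val t \subset s]%SET) =
    [&& u \in K, val t \subset u & #|u| == #|val t|.+1].
  by rewrite !inE -simplex_card -andbA [X in _ && X]andbC.
rewrite ifF => [|]; last first.
  apply/negP => /andP[_ /forall_inP hf].
  have : (0 < coface_degree K n (val t))%N by rewrite h.
  case/card_gt0P => u; rewrite cof => /and3P[uK tu /eqP cu].
  by have := hf u uK; rewrite finset.properEcard tu cu ltnSn.
rewrite -h /coface_degree -[RHS]sum1_card; apply: eq_big => [u|u /and3P[uK tu /eqP cu]].
  by rewrite cof.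
have uS : u \in simplexes K n.+1 by rewrite inE uK cu -simplex_card eqxx.
exact: (weight_top (Sub u uS)).
Qed.

Lemma ip_top f g : cochain_ip f g = \sum_s cochain_val f (o s) * cochain_val g (o s).
Proof.
rewrite (cochain_ipE _ _ o_orient); apply: eq_bigr => s _.
by rewrite weight_top mul1r.
Qed.

Lemma boundaryE d (q : simplex K d.+1 -> ordering V d.+1) (f : cochain R K d.+1) y :
  orientation q -> oriented K y ->
  cochain_val (boundary R K d f) y =
  \sum_(s : simplex K d.+1) cochain_val f (q s) * (incidence (q s) y)%:~R.
Proof.
move=> hq oy; rewrite {1}(cochain_decomp f hq) linear_sum cochain_val_sum /=.
apply: eq_bigr => s _; rewrite linearZ /= cochain_valZ.
rewrite boundary_elem ?(orders_oriented (hq s)) //.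
rewrite cochain_val_sum /incidence rmorph_sum; congr (_ * _); apply: eq_bigr => j _ /=.
rewrite cochain_valZ elemE face_oriented ?(orders_oriented (hq s)) //.
by rewrite rmorphM /= rmorphXn /= rmorphN1.
Qed.

Lemma coboundary_incidence d (u : cochain R K d) (x : ordering V d.+1) : oriented K x ->
  cochain_val (coboundary R K d u) x =
  \sum_(t : simplex K d) cochain_val u (std_ord t) * (incidence x (std_ord t))%:~R.
Proof.
move=> ox; rewrite coboundaryE ox.
under [RHS]eq_bigr do rewrite /incidence rmorph_sum mulr_sumr.
rewrite exchange_big; apply: eq_bigr => j _ /=.
have of_ := face_oriented j hK ox.
rewrite {1}(cochain_decomp u (@std_orientation V K d)) cochain_val_sum mulr_sumr.
apply: eq_bigr => t _; rewrite cochain_valZ elemE (orders_oriented (std_ordP t)).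
rewrite osignC; first by rewrite rmorphM /= rmorphXn /= rmorphN1 mulrCA.
  by have /andP[] := std_ordP t.
by have /andP[] := of_.
Qed.

(** The coboundary and the boundary are transposes of each other; the factor 1/2
    is the quotient of the weights of the N-simplexes and of their ridges. *)
Lemma adjoint_coboundary : adjoint (coboundary R K n) = (2^-1 *: boundary R K n)%VF.
Proof.
symmetry; apply: adjoint_uniq => // u v; rewrite cochain_ipC ip_top.
under eq_bigr => s _.
  rewrite coboundary_incidence ?(orders_oriented (o_orient s)) // mulr_sumr; over.
rewrite exchange_big; apply: eq_bigr => t _ /=.
rewrite weight_ridge scale_lfunE cochain_valZ.
rewrite (boundaryE _ o_orient) ?(orders_oriented (std_ordP t)) //.
rewrite -mulrA [_ * (_^-1 * _)]mulrCA mulVKf ?pnatr_eq0 // mulr_sumr.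
by apply: eq_bigr => s _; rewrite mulrCA.
Qed.

Definition neighbors s s' := (s' != s) && share_face K n (val s) (val s').

Lemma share_faceC d (a b : {set V}) : share_face K d a b = share_face K d b a.
Proof. by apply: eq_existsb => t; rewrite [X in _ && X]andbC. Qed.

Lemma neighborsC s s' : neighbors s s' = neighbors s' s.
Proof. by rewrite /neighbors eq_sym share_faceC. Qed.

Lemma other_coface s j :
  #|[pred s' : S | (s' != s) && (vertices (face j (o s)) \subset val s')]| = 1%N.
Proof.
have fo := face_oriented j hK (orders_oriented (o_orient s)).
have [t /andP[_ /eqP et]] := orientedP fo.
have ts : val t \subset val s by rewrite -et vertices_face ?o_inj // o_vertices subsetDl.
rewrite et; have := hdeg (valP t).
have -> : coface_degree K n (val t) = #|[pred s' : S | val t \subset val s']|.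
  rewrite /coface_degree -(card_imset [pred s' : S | val t \subset val s'] val_inj).
  apply: eq_card => u; rewrite inE; apply/andP/imsetP => [[uS tu]|[s' ts' ->]].
    by exists (Sub u uS).
  by split; [apply: valP|].
rewrite -cardsE (cardsD1 s) inE [s \in _]ts add1n => /succn_inj <-.
by rewrite -[RHS]cardsE; apply: eq_card => s'; rewrite !inE.
Qed.

(** Crossing a ridge of s reaches its other coface, and every neighbor of s is
    reached across exactly one ridge. *)
Lemma sum_over_faces s (G : S -> R) :
  \sum_(j < n.+2) \sum_(s' | (s' != s) && (vertices (face j (o s)) \subset val s')) G s' =
  \sum_(s' | neighbors s s') G s'.
Proof.
rewrite (exchange_big_dep (fun s' => s' != s)) /= => [|j s' _ /andP[]//].
rewrite [RHS]big_mkcondr /=; apply: eq_bigr => s' ss'.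
rewrite sumr_const.
have -> : #|[pred j | (s' != s) && (vertices (face j (o s)) \subset val s')]| =
   #|[set j | vertices (face j (o s)) \subset val s']%SET|.
  by apply: eq_card => j; rewrite !inE ss'.
rewrite (faces_in_other (K := K) (s := val s)) ?o_orient ?simplex_mem -?simplex_card //.
  by case: share_face.
by rewrite (inj_eq val_inj) eq_sym.
Qed.

Lemma card_neighbors s : #|neighbors s| = n.+2.
Proof.
have := sum_over_faces s (fun=> 1); rewrite sumr_const.
under eq_bigr do rewrite sumr_const other_coface.
rewrite sumr_const card_ord => /eqP; rewrite eqr_nat => /eqP ->.
by [].
Qed.

(** Across each ridge of s, coherence turns the boundary into the difference of
    the values of f at its two cofaces. *)
Lemma down_laplacianE f s : cochain_val (D f) (o s) =
  2^-1 * \sum_(s' | neighbors s s') (cochain_val f (o s) - cochain_val f (o s')).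
Proof.
rewrite -sum_over_faces /down_laplacian adjoint_coboundary comp_lfunE scale_lfunE.
have os := orders_oriented (o_orient s).
rewrite coboundaryE os mulr_sumr; apply: eq_bigr => j _.
have fo := face_oriented j hK os.
have [t ht] := orientedP fo.
have vt : vertices (face j (o s)) = val t by have /andP[_ /eqP] := ht.
rewrite cochain_valZ mulrCA; congr (_ * _).
rewrite (boundaryE _ o_orient) // (bigD1 s) //= incidence_face ?o_inj //.
rewrite rmorphXn rmorphN1 /= mulrDr mulrCA -expr2 sqrr_sign mulr1 sumrB.
(* There is one term f s per ridge, since s' runs over a single simplex. *)
rewrite sumr_const -[#|_|]/(#|[pred s' : S | (s' != s) && _]|) other_coface mulr1n.
congr (_ + _).
rewrite mulr_sumr -sumrN [RHS]big_mkcondr /=; apply: eq_bigr => s' ss'.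
case: ifPn => [ts'|nts']; last first.
  by rewrite incidence_nface ?o_inj ?o_vertices // !mulr0.
have -> : incidence (o s') (face j (o s)) = - incidence (o s) (face j (o s)).
  apply: (ho.2 s' s t) => //; rewrite -vt //.
  by rewrite vertices_face ?o_inj // o_vertices subsetDl.
rewrite incidence_face ?o_inj // rmorphN rmorphXn rmorphN1 /=.
by rewrite !mulrN mulrCA -expr2 sqrr_sign mulr1.
Qed.


Let sqr_opp1 : (-1) ^+ 2 = 1 :> R.
Proof. by rewrite sqrrN expr1n. Qed.

(** For eps = -1 the right-hand side is 2 D f, and for eps = 1 it is
    2 (n + 2 - D) f: the energy lemmas read off both ends of the spectrum. *)
Lemma sum_neighbors eps f s :
  \sum_(s' | neighbors s s') (cochain_val f (o s) + eps * cochain_val f (o s')) =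
  (1 + eps) * n.+2%:R * cochain_val f (o s) - eps * 2 * cochain_val (D f) (o s).
Proof.
have id (N a A : R) : N * a + eps * A = (1 + eps) * N * a - eps * 2 * (2^-1 * (N * a - A)).
  by field.
rewrite down_laplacianE big_split sumrB /= !sumr_const card_neighbors -mulr_sumr.
by rewrite -[cochain_val f (o s) *+ _]mulr_natl; exact: id.
Qed.

Lemma down_laplacian_self_adjoint f g : cochain_ip (D f) g = cochain_ip f (D g).
Proof.
rewrite /down_laplacian !comp_lfunE [RHS]cochain_ipC !(adjointP hK (coboundary R K n)).
exact: cochain_ipC.
Qed.

Lemma lker_down_laplacian : lker D = lker (adjoint (coboundary R K n)).
Proof.
apply/vspaceP => f; rewrite !memv_ker comp_lfunE.
apply/eqP/eqP => [Df|->]; last exact: linear0.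
apply: (cochain_ip_eq0 hK).
by rewrite -adjointP // Df /cochain_ip big1 // => s _; rewrite cochain_val0 mulr0 mul0r.
Qed.

Lemma kernel_neighbors f s s' : D f = 0 -> neighbors s s' ->
  cochain_val f (o s) = cochain_val f (o s').
Proof.
move=> Df ss'.
have := @neighbor_energy0 R _ neighbors (-1) (fun s => cochain_val f (o s))
  neighborsC sqr_opp1.
move=> /(_ _ s s' ss') ->; first by rewrite mulN1r opprK.
by move=> t; rewrite sum_neighbors Df cochain_val0 subrr !mul0r mulr0 subrr.
Qed.

Lemma top_neighbors f s s' : D f = n.+2%:R *: f -> neighbors s s' ->
  cochain_val f (o s) = - cochain_val f (o s').
Proof.
move=> Df ss'.
have := @neighbor_energy0 R _ neighbors 1 (fun s => cochain_val f (o s))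
  neighborsC (expr1n _ _).
move=> /(_ _ s s' ss') ->; first by rewrite mul1r.
by move=> t; rewrite sum_neighbors Df cochain_valZ mul1r mulrA subrr.
Qed.

Lemma cochain_neq0 f : f != 0 -> exists s, cochain_val f (o s) != 0.
Proof.
move=> f0; apply/existsP; apply: contraNT f0 => /existsPn h; apply/eqP.
apply: (cochain_eq_on o_orient) => s; rewrite cochain_val0.
by have /negPn/eqP := h s.
Qed.

Lemma down_eigenvalue_bounds a : passmx.leigenvalue D a -> 0 <= a <= n.+2%:R.
Proof.
move=> /leigenvalueP[f f0 Df]; have f_neq0 := cochain_neq0 f0.
have bound eps b : eps ^+ 2 = 1 -> (1 + eps) * n.+2%:R - eps * 2 * a = b -> 0 <= b.
  move=> eps2 eb; apply: (neighbor_energy_eigen neighborsC eps2 f_neq0) => s.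
  by rewrite sum_neighbors Df cochain_valZ mulrA -mulrBl eb.
have lo := bound (-1) (2 * a) sqr_opp1.
have hi := bound 1 (2 * (n.+2%:R - a)) (expr1n _ _).
have := lo ltac:(ring); have := hi ltac:(ring).
by rewrite !pmulr_rge0 // subr_ge0 => -> ->.
Qed.

(** A cochain of the kernel takes the same value at neighbors, and s has
    neighbors; so the elementary cochain at s is not in the kernel. *)
Lemma down_laplacian_neq0 s : D != 0.
Proof.
apply/eqP => D0; pose f : C := elem R K (o s).
have /card_gt0P[s' ss'] : (0 < #|neighbors s|)%N by rewrite card_neighbors.
have := @kernel_neighbors f s s'; rewrite D0 zero_lfunE => /(_ erefl ss').
rewrite /f !elemE !(orders_oriented (o_orient _)).
rewrite !osign_orientation // eqxx; move: ss' => /andP[/negbTE ss' _].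
by rewrite eq_sym ss' => /eqP; rewrite oner_eq0.
Qed.

Lemma connected_simplex (a b : {set V}) :
  connectedN K n a b -> a \in simplexes K n.+1 -> b \in simplexes K n.+1.
Proof.
move=> /connectP[q]; elim: q a => [|c q IH] a /=; first by move=> _ ->.
by move=> /andP[/and3P[_ cS _] cq] eb _; exact: IH cq eb cS.
Qed.

Lemma connected_neighbors (P : S -> Prop) s s' : connectedN K n (val s) (val s') ->
  (forall a b, neighbors a b -> P a -> P b) -> P s -> P s'.
Proof.
move=> /connectP[q + e] hP; elim: q s e => [|c q IH] s /=.
  by move=> /val_inj ->.
move=> e /andP[/and3P[_ cS sc] cq] Ps.
apply: (IH (Sub c cS)) => //.
have [es|ns] := eqVneq (Sub c cS) s; first by rewrite es.
by apply: hP Ps; rewrite /neighbors ns.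
Qed.

Lemma kernel_connected f s s' : D f = 0 -> connectedN K n (val s) (val s') ->
  cochain_val f (o s) = cochain_val f (o s').
Proof.
move=> Df /connected_neighbors h.
apply: (h (fun t => cochain_val f (o s) = cochain_val f (o t))) => //.
by move=> a b ab ->; exact: kernel_neighbors.
Qed.

Section Component.
Variable s : S.
Local Notation Comp := (component K n (val s)).

Lemma component_sub d : {subset simplexes Comp d <= simplexes K d}.
Proof.
move=> u; rewrite !inE => /andP[/andP[u0 /existsP[s' /andP[ss' us']]] ->]; rewrite andbT.
apply: hK.2 us' u0.
by have := connected_simplex ss' (valP s); rewrite inE => /andP[].
Qed.

(** A top simplex of the component is a face of a connected one of the same
    dimension, hence equal to it. *)
Lemma component_connected u : u \in simplexes Comp n.+1 -> connectedN K n (val s) u.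
Proof.
move=> /[dup] uC; rewrite !inE => /andP[/andP[u0 /existsP[s' /andP[ss' us']]] /eqP cu].
have := connected_simplex ss' (valP s); rewrite inE => /andP[_ /eqP cs'].
suff -> : u = s' by [].
by apply/eqP; rewrite eqEcard us' cu cs' leqnn.
Qed.

(** The component contains all cofaces of its ridges, so degrees are those in
    K. *)
Lemma component_constant_degree : constant_degree Comp n.
Proof.
exists 2%N => t tC; have tK := component_sub tC.
rewrite -(hdeg tK); apply: eq_card => u; rewrite !inE.
case: (boolP (t \subset u)) => [tu|_]; last by rewrite !andbF.
case: (boolP (#|u| == n.+2)) => [cu|_]; last by rewrite !andbF.
rewrite !andbT; apply/idP/idP => [/andP[u0 /existsP[s' /andP[ss' us']]]|uK].
  have := connected_simplex ss' (valP s); rewrite inE => /andP[s'K _].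
  exact: hK.2 us' u0.
have u0 : u != finset.set0 by rewrite -card_gt0 (eqP cu).
rewrite u0 /=; apply/existsP; exists u; rewrite fintype.subxx andbT.
move: tC; rewrite !inE => /andP[/andP[_ /existsP[s' /andP[ss' ts']]] _].
apply: (connect_trans ss' (connect1 _)).
rewrite /down_adj (connected_simplex ss' (valP s)) inE uK cu /=.
by apply/existsP; exists t; rewrite tK ts'.
Qed.

(** The eigenvector f changes sign between neighbors and vanishes nowhere on the
    component.  Reversing the orientation of the simplexes where f is negative
    turns the opposite incidences of neighbors into equal ones. *)
Lemma top_eigenvector_disorientable f : D f = n.+2%:R *: f ->
  cochain_val f (o s) != 0 -> disorientable Comp n.
Proof.
move=> Df fs.
pose lift_ (u : simplex Comp n.+1) : S := insubd s (val u).
have val_lift u : val (lift_ u) = val u.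
  by rewrite insubdK //; apply: component_sub (valP u).
have f_neq0 u : cochain_val f (o (lift_ u)) != 0.
  have : connectedN K n (val s) (val (lift_ u)).
    by rewrite val_lift; exact: component_connected (valP u).
  move=> /(connected_neighbors (P := fun a => cochain_val f (o a) != 0)); apply=> // a b ab.
  by rewrite (top_neighbors Df ab) oppr_eq0.
pose flip u := cochain_val f (o (lift_ u)) < 0.
pose swap : 'S_n.+2 := perm.tperm ord0 ord_max.
exists (fun u => if flip u then reorder (o (lift_ u)) swap else o (lift_ u)).
have inc_flip u y :
    incidence (if flip u then reorder (o (lift_ u)) swap else o (lift_ u)) y =
    (-1) ^+ flip u * incidence (o (lift_ u)) y.
  case: (flip u); last by rewrite mul1r.
  by rewrite incidence_reorder ?o_inj // perm.odd_tperm.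
split=> [u|a b t y ab ta tb oy].
  rewrite -val_lift; case: (flip u); last exact: o_orient.
  by rewrite /orders reorder_inj vertices_reorder; exact: o_orient.
have tK := component_sub (valP t).
have ab' : lift_ a != lift_ b by rewrite -(inj_eq val_inj) !val_lift (inj_eq val_inj).
have nab : neighbors (lift_ a) (lift_ b).
  rewrite /neighbors eq_sym ab' /= !val_lift; apply/existsP; exists (val t).
  by rewrite tK ta.
rewrite !inc_flip (ho.2 _ _ (Sub (val t) tK) _ ab') ?val_lift //.
have -> : flip a = ~~ flip b.
  rewrite /flip (top_neighbors Df nab) oppr_lt0 -leNgt le_eqVlt eq_sym.
  by rewrite (negbTE (f_neq0 b)).
by case: (flip b); rewrite ?mulN1r ?mul1r ?opprK.
Qed.

End Component.

(** Both sides give weight p to s and (1 - p) / (n + 2) to each of its n + 2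
    neighbors. *)
Lemma walk_stepE p (g : {ffun S -> R}) : cochain_of_fun o (walk_step p g) =
  cochain_of_fun o g - (2 * (1 - p) / n.+2%:R) *: D (cochain_of_fun o g).
Proof.
apply: (cochain_eq_on o_orient) => s.
rewrite cochain_of_funE // ffunE cochain_valD -scaleNr cochain_valZ.
rewrite down_laplacianE sumrB sumr_const card_neighbors.
have -> : \sum_(t | neighbors s t) cochain_val (cochain_of_fun o g) (o t) =
    \sum_(t | neighbors s t) g t by apply: eq_bigr => t _; rewrite cochain_of_funE.
rewrite cochain_of_funE //.
have -> : \sum_t transition p t s * g t =
    p * g s + (1 - p) / n.+2%:R * \sum_(t | neighbors s t) g t.
  rewrite (bigD1 s) //= /transition eqxx mulr_sumr; congr (_ + _).
  rewrite [RHS]big_mkcondr; apply: eq_bigr => t ts.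
  by rewrite eq_sym (negbTE ts) share_faceC; case: ifP; rewrite ?mul0r.
have id (N a A : R) : N != 0 -> p * a + (1 - p) / N * A =
    a + - (2 * (1 - p) / N) * (2^-1 * (N * a - A)).
  by move=> N0; field.
by rewrite -[g s *+ _]mulr_natl; apply: id; rewrite pnatr_eq0.
Qed.

Lemma walk_cochainE p s t : walk_cochain o p s t =
  iter t (fun z => z - (2 * (1 - p) / n.+2%:R) *: D z) (walk_cochain o p s 0).
Proof.
elim: t => [//|t IH]; rewrite iterS -IH /walk_cochain iterS; exact: walk_stepE.
Qed.

Lemma top_cochain0 (u : cochain R K n.+2) : u = 0.
Proof.
apply: cochain_valP => x; rewrite cochain_val0 cochain_val_off //.
apply/negP => /orientedP[u' _]; have := hdim.2 _ (simplex_mem u').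
by rewrite -simplex_card ltnn.
Qed.

Lemma up_laplacian0 : up_laplacian R K n.+1 = 0.
Proof.
apply/lfunP => f; rewrite /up_laplacian comp_lfunE zero_lfunE.
by rewrite [coboundary _ _ _ f]top_cochain0 linear0.
Qed.

Lemma dim_homology : \dim (homology R K n.+1) = \dim (lker (adjoint (coboundary R K n))).
Proof.
have -> : lker (adjoint (coboundary R K n)) = cycles R K n.+1.
  apply/vspaceP => f; rewrite adjoint_coboundary !memv_ker scale_lfunE scaler_eq0.
  by rewrite invr_eq0 pnatr_eq0.
have b0 : limg (boundary R K n.+1) = 0%VS.
  apply/eqP; rewrite -subv0; apply/subvP => f /memv_imgP[u _ ->].
  by rewrite (top_cochain0 u) linear0 mem0v.
rewrite -(dimv_cap_compl (cycles R K n.+1) (limg (boundary R K n.+1))).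
by rewrite b0 capv0 dimv0 add0n /homology b0.
Qed.

End ClosedComplex.

(** * Convergence of the walk *)

Section LimitOfWalk.
Variables (R : realType) (V : finType) (K : {set {set V}}) (n : nat).
Variables (o : simplex K n.+1 -> ordering V n.+1) (p : R).
Hypothesis hK : simplicial_complex K.
Hypothesis hdim : dim_complex K n.+1.
Hypothesis hdeg : forall t, t \in simplexes K n -> coface_degree K n t = 2%N.
Hypothesis ho : coherent o.
Hypothesis hp : 0 <= p <= 1.

Local Notation S := (simplex K n.+1).
Local Notation C := (cochain R K n.+1).
Local Notation D := (down_laplacian R K n).
Local Notation ker := (lker (adjoint (coboundary R K n))).
Local Notation limit s := (orth_proj ker (walk_cochain o p s 0)).
Local Notation k := (2 * (1 - p) / n.+2%:R).

Lemma ip_elem (f : C) (s : S) : cochain_ip f (elem R K (o s)) = cochain_val f (o s).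
Proof.
rewrite (ip_top hdim ho) (bigD1 s) //= elemE (orders_oriented (ho.1 s)).
rewrite osign_orientation ?eqxx ?mulr1; last exact: ho.1.
rewrite big1 ?addr0 // => t ts.
rewrite elemE (orders_oriented (ho.1 _)) osign_orientation; last exact: ho.1.
by rewrite eq_sym (negbTE ts) mulr0.
Qed.

Lemma walk_cochain0 (s : S) : walk_cochain o p s 0 = elem R K (o s).
Proof.
rewrite /walk_cochain /= /cochain_of_fun (bigD1 s) //= ffunE eqxx scale1r.
by rewrite big1 ?addr0 // => t ts; rewrite ffunE (negbTE ts) scale0r.
Qed.

Let e (i : 'I_#|{: S}|) : C := elem R K (o (enum_val i)).

Lemma elem_expand (f : C) : f = \sum_i cochain_ip f (e i) *: e i.
Proof.
rewrite {1}(cochain_decomp f ho.1) (reindex (@enum_val _ {: S})) /=; last first.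
  by apply: onW_bij; exact: enum_val_bij.
by apply: eq_bigr => i _; rewrite /e ip_elem.
Qed.

Let ip_sym (f g : C) : cochain_ip f g = cochain_ip g f := cochain_ipC f g.
Let ip_lin a (f g h : C) := cochain_ipP a f g h.
Let ip_ge0 (f : C) := cochain_ip_ge0 hK f.
Let ip_eq0 (f : C) := @cochain_ip_eq0 R V K hK _ f.
Let D_sym (f g : C) := down_laplacian_self_adjoint hK f g.

Lemma gap_exists (s : S) : exists lam, is_spectral_gap D lam.
Proof.
exact: (spectral_gap_exists ip_sym ip_lin ip_eq0 elem_expand D_sym
  (down_laplacian_neq0 R hK hdim hdeg ho s)).
Qed.

Lemma dis_walk_le (rho : R) (s : S) t : 0 <= rho ->
  (forall a, passmx.leigenvalue D a -> a != 0 -> `|1 - k * a| <= rho) ->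
  dis (walk_cochain o p s t) (limit s) <= rho ^+ t * dis (walk_cochain o p s 0) 0.
Proof.
move=> rho0 hrho.
have [x0 [Dx0 orth close]] := iterates_near_kernel ip_sym ip_lin ip_ge0
  elem_expand D_sym (walk_cochain o p s 0).
have -> : limit s = x0.
  symmetry; apply: orth_proj_uniq => //; split=> [|u].
    by rewrite -lker_down_laplacian // memv_ker Dx0.
  by rewrite -lker_down_laplacian // memv_ker => /eqP; exact: orth.
rewrite /dis (walk_cochainE hK hdim hdeg ho) subr0.
apply: le_trans (ler_wsqrtr (close k rho hrho t)) _.
by rewrite sqrtrM ?sqr_ge0 // sqrtr_sqr ger0_norm ?exprn_ge0.
Qed.

Lemma walk_cvg_limit (s : S) :
  (forall a, passmx.leigenvalue D a -> a != 0 -> `|1 - k * a| < 1) ->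
  cvg_cochain (walk_cochain o p s) (limit s).
Proof.
move=> hk.
have [rho [/andP[rho0 rho1] hrho]] :=
  eigenvalue_rate ip_sym ip_lin ip_eq0 elem_expand D_sym hk.
rewrite /cvg_cochain.
apply: (@squeeze_cvgr _ _ _ _ (fun=> 0) (fun t => rho ^+ t * dis (walk_cochain o p s 0) 0)).
- by near=> t; rewrite sqrtr_ge0 dis_walk_le.
- exact: cvg_cst.
- rewrite -[X in (_ --> X)%classic](mul0r (dis (walk_cochain o p s 0) 0)).
  by apply: cvgM; [apply: cvg_expr; rewrite ger0_norm|exact: cvg_cst].
Unshelve. all: by end_near.
Qed.

(** The point masses at two connected simplexes pair equally with the cochains
    of the kernel, which are constant along chains of neighbors. *)
Lemma limit_connected (s s' : S) : connectedN K n (val s) (val s') -> limit s' = limit s.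
Proof.
move=> ss'; symmetry; apply: orth_proj_uniq => //.
have [memU orth] := orth_projP hK ker (walk_cochain o p s 0).
split=> [|u uU]; first exact: memU.
have Du : D u = 0 by apply/eqP; rewrite -memv_ker (lker_down_laplacian R n hK).
have ipB (f g : C) : cochain_ip (f - g) u = cochain_ip f u - cochain_ip g u.
  by rewrite addrC -scaleN1r cochain_ipP mulN1r addrC.
have := orth u uU; rewrite !walk_cochain0; move: (limit s) => L.
rewrite 2!ipB => <-; congr (_ - _); rewrite !(cochain_ipC _ u) !ip_elem.
by rewrite (kernel_connected hK hdim hdeg ho Du ss').
Qed.

(** With q = a / (n + 2), which lies in (0, 1], the factor is
    1 - 2 (1 - p) q. *)
Lemma lazy_rate : 0 < p < 1 ->
  forall a, passmx.leigenvalue D a -> a != 0 -> `|1 - k * a| < 1.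
Proof.
move=> /andP[p0 p1] a ha a0.
have /andP[a_ge0 a_le] := down_eigenvalue_bounds hK hdim hdeg ho ha.
have a_gt0 : 0 < a by rewrite lt_def a0.
have N0 : 0 < n.+2%:R :> R by rewrite ltr0n.
have q_gt0 : 0 < a / n.+2%:R by rewrite divr_gt0.
have q_le1 : a / n.+2%:R <= 1 by rewrite ler_pdivrMr // mul1r.
rewrite mulrAC -mulrA; set q := a / _ in q_gt0 q_le1 *.
rewrite ltr_norml; apply/andP; split; nra.
Qed.

(** Without laziness the factor is 1 - 2 q, which has absolute value 1 only at
    the top eigenvalue n + 2; an eigenvector for it disorients a component. *)
Lemma nonlazy_rate : p = 0 ->
  ~ (exists s, [/\ s \in simplexes K n.+1, disorientable (component K n s) n &
                   constant_degree (component K n s) n]) ->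
  forall a, passmx.leigenvalue D a -> a != 0 -> `|1 - k * a| < 1.
Proof.
move=> p0 no_dis a ha a0.
have /andP[a_ge0 a_le] := down_eigenvalue_bounds hK hdim hdeg ho ha.
have a_gt0 : 0 < a by rewrite lt_def a0.
have N0 : 0 < n.+2%:R :> R by rewrite ltr0n.
have a_lt : a < n.+2%:R.
  rewrite lt_neqAle a_le andbT; apply/eqP => aN; apply: no_dis.
  have /leigenvalueP[f f0 Df] := ha; rewrite aN in Df.
  have [s fs] := cochain_neq0 ho f0; exists (val s); split; first exact: valP.
    exact: (top_eigenvector_disorientable hK hdim hdeg ho Df fs).
  exact: component_constant_degree.
have q_gt0 : 0 < a / n.+2%:R by rewrite divr_gt0.
have q_lt1 : a / n.+2%:R < 1 by rewrite ltr_pdivrMr // mul1r.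
rewrite mulrAC -mulrA p0; set q := a / _ in q_gt0 q_lt1 *.
rewrite ltr_norml; apply/andP; split; nra.
Qed.

(** For p >= 1/2 every factor 1 - k a is nonnegative, so the dominant one is
    that of the smallest nonzero eigenvalue. *)
Lemma gap_rate lam : 1 / 2 <= p -> is_spectral_gap D lam ->
  0 <= 1 - k * lam /\
  forall a, passmx.leigenvalue D a -> a != 0 -> `|1 - k * a| <= 1 - k * lam.
Proof.
move=> p_half [hlam lam0 lam_min].
have /andP[p0 p1] := hp.
have N0 : 0 < n.+2%:R :> R by rewrite ltr0n.
have k0 : 0 <= k by rewrite divr_ge0 ?(ltW N0) // mulr_ge0 // subr_ge0.
have ge0 a : passmx.leigenvalue D a -> 0 <= 1 - k * a.
  move=> ha; have /andP[a_ge0 a_le] := down_eigenvalue_bounds hK hdim hdeg ho ha.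
  have q_ge0 : 0 <= a / n.+2%:R by rewrite divr_ge0 // ltW.
  have q_le1 : a / n.+2%:R <= 1 by rewrite ler_pdivrMr // mul1r.
  rewrite mulrAC -mulrA; set q := a / _ in q_ge0 q_le1 *; nra.
split=> [|a ha a0]; first exact: ge0.
by rewrite ger0_norm ?ge0 // lerB // ler_wpM2l // lam_min.
Qed.

Lemma walk_bigO lam (s : S) : 1 / 2 <= p -> is_spectral_gap D lam ->
  exists pinf : C, cvg_cochain (walk_cochain o p s) pinf /\
    (((fun t => dis (walk_cochain o p s t) pinf) : nat -> R^o) =O_\oo
      ((fun t => (1 - k * lam) ^+ t) : nat -> R^o))%classic.
Proof.
move=> p_half gap; have [rate0 rate] := gap_rate p_half gap.
(* For p = 1 the walk does not move, and its limit is the point mass itself. *)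
have [p1|p1] := eqVneq p 1.
  have const t : dis (walk_cochain o p s t) (walk_cochain o p s 0) = 0.
    have -> : walk_cochain o p s t = walk_cochain o p s 0.
      rewrite (walk_cochainE hK hdim hdeg ho); elim: t => //= t ->.
      by rewrite p1 subrr mulr0 mul0r scale0r subr0.
    by rewrite /dis subrr /cochain_ip big1 ?sqrtr0 // => u _; rewrite cochain_val0 mulr0.
  exists (walk_cochain o p s 0); split.
    rewrite /cvg_cochain; under eq_cvg do rewrite const; exact: cvg_cst.
  apply/eqO_exP; exists 1 => //; near=> t.
  by rewrite const normr0 mul1r.
have p01 : 0 < p < 1.
  have /andP[_ p_le1] := hp; apply/andP; split; last by rewrite lt_neqAle p1.
  by apply: lt_le_trans p_half; rewrite divr_gt0.
exists (limit s); split; first by apply: walk_cvg_limit; exact: lazy_rate.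
apply/eqO_exP; exists (dis (walk_cochain o p s 0) 0 + 1).
  by rewrite ltr_wpDl ?sqrtr_ge0.
near=> t.
rewrite ger0_norm ?sqrtr_ge0 // ger0_norm ?exprn_ge0 //.
apply: le_trans (dis_walk_le s t rate0 rate) _.
by rewrite mulrC ler_wpM2r ?exprn_ge0 // lerDl.
Unshelve. all: by end_near.
Qed.

End LimitOfWalk.

Unset Implicit Arguments.
Set Strict Implicit.
Set Printing Implicit Defensive.

Theorem theorem3p12 (R : realType) (V : finType) (K : {set {set V}}) (n : nat)
    (o : simplex K n.+1 -> ordering V n.+1) (p : R)
    (hK : simplicial_complex K) (hdim : dim_complex K n.+1)
    (hdeg : forall t, t \in simplexes K n -> coface_degree K n t = 2%N)
    (ho : coherent o) (hp : 0 <= p <= 1) :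
  [/\ (0 < p < 1 \/
       p = 0 /\ ~ (exists s, [/\ s \in simplexes K n.+1,
                                 disorientable (component K n s) n &
                                 constant_degree (component K n s) n])) ->
      forall s0 : simplex K n.+1, exists pinf : cochain R K n.+1,
        [/\ cvg_cochain (walk_cochain o p s0) pinf,
            forall s1 : simplex K n.+1, connectedN K n (val s0) (val s1) ->
              cvg_cochain (walk_cochain o p s1) pinf &
            pinf = orth_proj (lker (adjoint (coboundary R K n)))
                     (walk_cochain o p s0 0)],
      [/\ lker (down_laplacian R K n) = lker (adjoint (coboundary R K n)),
          up_laplacian R K n.+1 = 0,
          lker (laplacian R K n) = lker (down_laplacian R K n) &
          \dim (homology R K n.+1) = \dim (lker (adjoint (coboundary R K n)))] &
      1 / 2 <= p ->
      exists lam : R, is_spectral_gap (down_laplacian R K n) lam /\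
      forall s0 : simplex K n.+1, exists pinf : cochain R K n.+1,
        cvg_cochain (walk_cochain o p s0) pinf /\
        (((fun t => dis (walk_cochain o p s0 t) pinf) : nat -> R^o) =O_\oo
          ((fun t => (1 - 2 * (1 - p) / n.+2%:R * lam) ^+ t) : nat -> R^o)
        )%classic].
Proof.
split.
- move=> hrate s0.
  have rate : forall a, passmx.leigenvalue (down_laplacian R K n) a -> a != 0 ->
      `|1 - 2 * (1 - p) / n.+2%:R * a| < 1.
    case: hrate => [hp01|[p0 no_dis]]; first exact: (lazy_rate hK hdim hdeg ho hp01).
    exact: (nonlazy_rate hK hdim hdeg ho p0 no_dis).
  exists (orth_proj (lker (adjoint (coboundary R K n))) (walk_cochain o p s0 0)).
  split=> // [|s1 s01]; first exact: walk_cvg_limit.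
  rewrite -(limit_connected p hK hdim hdeg ho s01); exact: walk_cvg_limit.
- split.
  + exact: lker_down_laplacian.
  + exact: up_laplacian0.
  + by rewrite /laplacian up_laplacian0 // add0r.
  + exact: (dim_homology R hK hdim hdeg ho).
- move=> p_half.
  have s : simplex K n.+1.
    by case: hdim => /finset.set0Pn/cid[u uK] _; exists u.
  have [lam gap] := gap_exists R hK hdim hdeg ho s.
  exists lam; split=> // s0; exact: walk_bigO.
Qed.
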